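(* Consider the scalar quadratic Gaussian signaling game with source $m\sim\mathcal{N}(0,\mathbb{E}[m^2])$, channel noise $w\sim\mathcal{N}(0,\mathbb{E}[w^2])$ independent of $m$ (both variances positive), encoder cost $(m-u-b)^2+\lambda x^2$ and decoder cost $(m-u)^2$, with $b\in\mathbb{R}$ and $\lambda\ge 0$. Then the price of anarchy is always larger than $1$; i.e., the sum of the costs $J^e+J^d$ under any Nash equilibrium is always larger than the socially optimal cost $\min_{\gamma^e,\gamma^d}(J^e+J^d)$.
   Context: The encoder observes $m$ and sends a real-valued $x=\gamma^e(m)$; the decoder receives $y=x+w$ and chooses $u=\gamma^d(y)\in\mathbb{R}$; policies are measurable functions. The costs, each to be minimized by the respective player, are $J^e(\gamma^e,\gamma^d)=\mathbb{E}[(m-u-b)^2+\lambda x^2]$ for the encoder and $J^d(\gamma^e,\gamma^d)=\mathbb{E}[(m-u)^2]$ for the decoder. The value $\lambda=0$ corresponds to no power constraint at the encoder. A pair $(\gamma^{*,e},\gamma^{*,d})$ is a Nash equilibrium if $J^e(\gamma^{*,e},\gamma^{*,d})\le J^e(\gamma^e,\gamma^{*,d})$ for all $\gamma^e$ and $J^d(\gamma^{*,e},\gamma^{*,d})\le J^d(\gamma^{*,e},\gamma^d)$ for all $\gamma^d$. The price of anarchy is the ratio between the game-theoretic total cost ($J^e+J^d$ at a Nash equilibrium) and the socially optimal cost $\min_{\gamma^e,\gamma^d}(J^e+J^d)$.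
   Formalization: Strictness is not claimed for equilibria with x=0 almost surely when b=0 and λ≥2E[m²]/E[w²]: there the total cost equals the social optimum 2E[m²] and the price of anarchy is 1, so only ≥ is stated. The minimum is read as an infimum. *)

(* Defs.v *)
From HB Require Import structures.
From mathcomp Require Import all_boot all_order all_algebra.
From mathcomp Require Import all_classical all_reals all_analysis.

Set Implicit Arguments.
Unset Strict Implicit.
Unset Printing Implicit Defensive.

Import Order.TTheory GRing.Theory Num.Theory.
Import numFieldNormedType.Exports.

Local Open Scope classical_set_scope.
Local Open Scope ring_scope.

Definition independent_RV d (T : measurableType d) (R : realType)
    (P : probability T R) (X Y : {RV P >-> R}) : Prop :=
  forall A B : set R, measurable A -> measurable B ->
    P ((X @^-1` A) `&` (Y @^-1` B)) = (P (X @^-1` A) * P (Y @^-1` B))%E.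

(* [normal_prob mu s] takes the standard deviation: here E[m^2] = sm^2 and
   E[w^2] = sw^2. *)
Definition gaussian_source_and_noise d (T : measurableType d) (R : realType)
    (P : probability T R) (m w : {RV P >-> R}) (sm sw : R) : Prop :=
  [/\ forall A : set R, measurable A ->
        distribution P m A = normal_prob 0 sm A,
      forall A : set R, measurable A ->
        distribution P w A = normal_prob 0 sw A
    & independent_RV m w].

Section signaling_game.
Context d (T : measurableType d) (R : realType) (P : probability T R).
Variables (m w : {RV P >-> R}) (b lambda : R).

Definition policy : Type := {mfun R >-> R}.

Definition channel_input (ge : policy) (t : T) : R := ge (m t).

Definition action (ge gd : policy) (t : T) : R :=
  gd (channel_input ge t + w t).

(* The integrands are nonnegative for 0 <= lambda, so the expectations are
   always meaningful in the extended reals, +oo being a possible cost. *)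
Definition encoder_cost (ge gd : policy) : \bar R :=
  'E_P[fun t => (m t - action ge gd t - b) ^+ 2
                + lambda * channel_input ge t ^+ 2].

Definition decoder_cost (ge gd : policy) : \bar R :=
  'E_P[fun t => (m t - action ge gd t) ^+ 2].

Definition nash_equilibrium (ge gd : policy) : Prop :=
  (forall ge' : policy, (encoder_cost ge gd <= encoder_cost ge' gd)%E) /\
  (forall gd' : policy, (decoder_cost ge gd <= decoder_cost ge gd')%E).

Definition total_cost (ge gd : policy) : \bar R :=
  (encoder_cost ge gd + decoder_cost ge gd)%E.

(* An infimum, since for lambda = 0 the minimum need not be attained. *)
Definition social_cost : \bar R :=
  ereal_inf [set total_cost g.1 g.2 | g in [set: policy * policy]].

(* In the extended reals 0^-1 = +oo, so the ratio is +oo when the socially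
   optimal cost is 0 and the equilibrium cost is positive. *)
Definition price_of_anarchy (ge gd : policy) : \bar R :=
  (total_cost ge gd / social_cost)%E.

End signaling_game.

(* Main.v *)
Require Import Defs.
From HB Require Import structures.
From mathcomp Require Import all_boot all_order all_algebra.
From mathcomp Require Import all_classical all_reals all_analysis.
From mathcomp Require Import measurable_realfun normal_distribution.
From mathcomp Require Import ring lra.

Set Implicit Arguments.
Unset Strict Implicit.
Unset Printing Implicit Defensive.

Import Order.TTheory GRing.Theory Num.Theory.
Import numFieldNormedType.Exports.

Local Open Scope classical_set_scope.
Local Open Scope ring_scope.

(** Outside the silent equilibrium of the last case below, a Nash equilibrium does
    not minimize the total cost. Write [D = m - u].

    - If [b != 0], the decoder is tuned to [E D^2] alone, and shifting its action
      by [- b / 2] lowers the total cost by [b^2 / 2].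
    - If [b = 0] and [lambda = 0], signalling [k m] with [k] large makes the total
      cost arbitrarily small, whereas [E D^2 > 0] for every pair of policies.
    - If [b = 0], [lambda > 0] and the input is not a.s. [0], the encoder minimizes
      [E D^2 + lambda E x^2] and not [2 E D^2 + lambda E x^2]. At a common minimizer
      the perturbation of [x] by [e] on a set where [x] is bounded away from [0]
      would have two incompatible first-order conditions. No derivative is needed:
      the Gaussian kernel has second differences of order [e^2], dominated by its
      translates by [1] and [- 1]. The perturbed costs are finite because the
      decoder is optimal on every (weighted) set of channel outputs, which bounds
      the growth of its action.
    - If [b = 0] and [x = 0] a.s., then [E D^2 >= E m^2], and for
      [lambda < 2 E m^2 / E w^2] a weak linear signal does better. *)

(** * Integration tools *)

Section lebesgue_translation.
Context {R : realType}.
Local Notation mu := (@lebesgue_measure R).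

(** The pushforward has the right value on half-open intervals, which determine Lebesgue measure. *)
Lemma lebesgue_measure_translation (c : R) (A : set R) : measurable A ->
  pushforward mu (fun x : R => x + c : measurableTypeR R) A = mu A.
Proof.
move=> mA; apply/esym/lebesgue_measure_unique => //=.
  exact: measurable_funD.
move=> mc _ [[a b]] _ <-; rewrite /pushforward.
rewrite (_ : _ @^-1` _ = `]a - c, b - c]%classic); last first.
  by apply/seteqP; split => x /=; rewrite !in_itv/= ltrBlDr lerBrDr.
rewrite !lebesgue_measure_itv/= !lte_fin ltrD2r.
by case: ifPn => // _; rewrite -!EFinB opprB addrA subrK.
Qed.

Lemma ge0_integral_translation (c : R) (f : R -> \bar R) :
  measurable_fun [set: R] f -> (forall x, 0 <= f x)%E ->
  (\int[mu]_x f x = \int[mu]_x f (x + c)%R)%E.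
Proof.
move=> mf f0.
pose sh (x : measurableTypeR R) : measurableTypeR R := (x : R) + c.
have msh : measurable_fun [set: measurableTypeR R] sh.
  exact: measurable_funD.
rewrite -(ge0_integral_pushforward msh (D := setT) mu (f := f))//.
by apply: eq_measure_integral => A mA _; exact/esym/lebesgue_measure_translation.
Qed.

Lemma ge0_integral_opp (f : R -> \bar R) :
  measurable_fun [set: R] f -> (forall x, 0 <= f x)%E ->
  (\int[mu]_x f x = \int[mu]_x f (- x)%R)%E.
Proof.
move=> mf f0.
pose op (x : measurableTypeR R) : measurableTypeR R := - (x : R).
have mop : measurable_fun [set: measurableTypeR R] op by exact: oppr_measurable.
rewrite -(ge0_integral_pushforward mop (D := setT) mu (f := f))//.
by apply: eq_measure_integral => A mA _; exact/esym/lebesgue_measureN.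
Qed.

End lebesgue_translation.

Section gaussian_density.
Context {R : realType}.
Local Notation mu := (@lebesgue_measure R).

(** The Radon-Nikodym derivative of the Gaussian law and [normal_pdf] have the same integral over
    every measurable set, hence agree almost everywhere. *)
Lemma ge0_integral_normal_prob (c s : R) (f : R -> \bar R) :
  measurable_fun [set: R] f -> (forall x, 0 <= f x)%E ->
  (\int[normal_prob c s]_x f x = \int[mu]_x (f x * (normal_pdf c s x)%:E))%E.
Proof.
move=> mf f0.
rewrite -(Radon_Nikodym_SigmaFinite.change_of_variables
  (normal_prob_dominates c s))//.
have mpdf : measurable_fun [set: R] (fun x => (normal_pdf c s x)%:E).
  by apply/measurable_EFinP; exact: measurable_normal_pdf.
have iRN := Radon_Nikodym_SigmaFinite.f_integrable (normal_prob_dominates c s).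
apply: ge0_ae_eq_integral => //.
- by apply: emeasurable_funM => //; exact: measurable_int iRN.
- exact: emeasurable_funM.
- move=> x _; apply: mule_ge0 => //; apply: Radon_Nikodym_SigmaFinite.f_ge0.
  exact: normal_prob_dominates.
- by move=> x _; rewrite mule_ge0// lee_fin normal_pdf_ge0.
- apply: ae_eqe_mul2l; apply: integral_ae_eq => // E _ mE.
  rewrite -Radon_Nikodym_SigmaFinite.f_integral//.
  exact: normal_prob_dominates.
Qed.

End gaussian_density.

Section joint_law.
Context d (T : measurableType d) (R : realType) (P : probability T R).
Variables (X Y : {RV P >-> R}).

(** By independence the law of the pair takes the product values on rectangles, and these determine
    the product measure. *)
Lemma independent_RV_ge0_integral (N W : probability (measurableTypeR R) R)
    (f : R * R -> \bar R) :
  (forall A : set R, measurable A -> distribution P X A = N A) ->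
  (forall A : set R, measurable A -> distribution P Y A = W A) ->
  independent_RV X Y ->
  measurable_fun [set: R * R] f -> (forall z, 0 <= f z)%E ->
  (\int[P]_t f (X t, Y t) = \int[(N \x W)%E]_z f z)%E.
Proof.
move=> XN YW indep mf f0.
pose XY t : measurableTypeR R * measurableTypeR R := (X t, Y t).
have mXY : measurable_fun [set: T] XY.
  apply/measurable_fun_pairP; split.
    exact: (measurable_funPT X).
  exact: (measurable_funPT Y).
rewrite -(ge0_integral_pushforward mXY (D := setT) P (f := f))//.
apply: eq_measure_integral => A mA _; apply/esym.
apply: product_measure_unique => // B C mB mC.
rewrite -[LHS]/(P (X @^-1` B `&` Y @^-1` C)) indep//.
by congr (_ * _)%E; [exact: XN|exact: YW].
Qed.
End joint_law.

(** * Gaussian kernel *)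

Section exponential_inequalities.
Context {R : realType}.
Implicit Types t x y L : R.

Lemma expR_double_difference_ge0 t : 0 <= expR t + expR (- t) - 2.
Proof.
have e0 := expR_gt0 t; have e1 : expR t * expR (- t) = 1 by rewrite -expRD subrr expR0.
have e2 := expR_gt0 (- t); move: (expR t) (expR (- t)) e0 e1 e2 => e f e0 ef f0.
have := sqr_ge0 (e - f); rewrite expr2; nra.
Qed.

(** For d(u) = e^u + e^(-u) - 2 one has d(2u) = d(u)^2 + 4 d(u), so each halving of the argument
    gains a factor 4. Dyadic steps suffice for the limiting argument at the end. *)
Lemma expR_double_difference_dyadic t n :
  expR (2^-1 ^+ n * t) + expR (- (2^-1 ^+ n * t)) - 2 <=
  (2^-1 ^+ n) ^+ 2 * (expR t + expR (- t) - 2).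
Proof.
elim: n t => [|n ih] t; first by rewrite expr0 expr1n !mul1r.
rewrite exprSr -mulrA; apply: (le_trans (ih _)).
rewrite exprMn -[leRHS]mulrA ler_wpM2l ?sqr_ge0//.
set u := 2^-1 * t; have -> : t = u + u by rewrite /u; lra.
rewrite [- (u + u)]opprD !expRD; have := expR_double_difference_ge0 u.
have : expR u * expR (- u) = 1 by rewrite -expRD subrr expR0.
move: (expR u) (expR (- u)) => e f ef d0.
rewrite -subr_ge0 [leRHS](_ : _ =
  2^-1 ^+ 2 * (e + f - 2) ^+ 2 + 2^-1 * (1 - e * f)); last by field.
by rewrite ef subrr mulr0 addr0 mulr_ge0// sqr_ge0.
Qed.

Lemma expRM_le_envelope x y L : `|x| <= L ->
  expR (x * y) <= expR (L * y) + expR (- (L * y)).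
Proof.
move=> xL; have h : x * y <= L * `|y|.
  by rewrite (le_trans (ler_norm _))// normrM ler_wpM2r.
have [y0|y0] := leP 0 y.
- rewrite ger0_norm// in h; rewrite (@le_trans _ _ (expR (L * y))) ?ler_expR//.
  by rewrite lerDl expR_ge0.
- rewrite ltr0_norm// mulrN in h.
  rewrite (@le_trans _ _ (expR (- (L * y)))) ?ler_expR//.
  by rewrite lerDr expR_ge0.
Qed.

(** For a nonnegative argument the fourth Taylor term is at most the exponential; 24 is 4!. *)
Lemma pow4_le_expR t : t ^+ 4 <= 24 * (expR t + expR (- t)).
Proof.
have h (u : R) : 0 <= u -> u ^+ 4 <= 24 * expR u.
  move=> u0; have := expR_ge1Dxn 3 u0; rewrite (_ : 4`!%:R = 24 :> R)//.
  by move: (u ^+ 4) (expR u) => a e; lra.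
have [t0|t0] := leP 0 t.
  have := h _ t0; have := expR_ge0 (- t); lra.
have := h _ (ltW (eqbRL (oppr_gt0 t) t0)); have := expR_ge0 t.
rewrite (_ : (- t) ^+ 4 = t ^+ 4); last by ring.
lra.
Qed.

End exponential_inequalities.

Section gaussian_density_inequalities.
Context {R : realType}.
Variable s : R.
Hypothesis s0 : s != 0.
Implicit Types c t x y L : R.

Local Notation damp t := (expR (- (t ^+ 2 / (s ^+ 2 *+ 2)))).

Lemma normal_pdf_gt0 c x : 0 < normal_pdf c s x.
Proof.
by rewrite normal_pdfE//= mulr_gt0 ?normal_peak_gt0// /normal_fun expR_gt0.
Qed.

(** Completing the square: moving the mean by [t] costs a constant factor [damp t] and an
    exponential tilt. Comparisons of translates thereby reduce to comparisons of exponentials. *)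
Lemma normal_pdfDm c t y :
  normal_pdf (c + t) s y =
  normal_pdf c s y * damp t * expR (t * ((y - c) / s ^+ 2)).
Proof.
rewrite !normal_pdfE// -!mulrA -!expRD /normal_fun; congr (_ * expR _).
by field.
Qed.

Lemma normal_pdf_tilt t y :
  normal_pdf t s y = normal_pdf 0 s y * damp t * expR (t * (y / s ^+ 2)).
Proof. by rewrite -[t in LHS]add0r normal_pdfDm subr0. Qed.

(** After factoring out the density at [x], this is the dyadic bound on e^z + e^(-z) - 2 together
    with [damp e <= 1]. The constant undoes the damping of the translates by 1 and -1. *)
Lemma normal_pdf_second_difference : exists2 C, 0 <= C & forall x y n,
  normal_pdf (x + 2^-1 ^+ n) s y + normal_pdf (x - 2^-1 ^+ n) s y <=
  2 * normal_pdf x s y + C * (2^-1 ^+ n) ^+ 2 *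
    (normal_pdf (x + 1) s y + normal_pdf (x - 1) s y).
Proof.
exists (damp 1)^-1; first by rewrite invr_ge0 expR_ge0.
move=> x y n; rewrite !normal_pdfDm !sqrrN expr1n !mulN1r !mulNr !mul1r.
set z := (y - x) / _; set p := normal_pdf x s y; set e := 2^-1 ^+ n.
have p0 : 0 <= p by exact: normal_pdf_ge0.
have d1 : damp e <= 1.
  rewrite -[leRHS]expR0 ler_expR oppr_le0.
  by rewrite divr_ge0// ?sqr_ge0// mulrn_wge0// sqr_ge0.
have d0 := expR_ge0 (- (e ^+ 2 / (s ^+ 2 *+ 2))).
have h := expR_double_difference_dyadic z n; rewrite -/e in h.
rewrite (_ : _^-1 * _ * _ = e ^+ 2 * (p * (expR z + expR (- z)))); last first.
  by field; rewrite gt_eqF// expR_gt0.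
rewrite -mulrDr (@le_trans _ _ (p * (expR (e * z) + expR (- (e * z)))))//.
  by rewrite ler_wpM2r ?addr_ge0 ?expR_ge0// ler_piMr.
have := sqr_ge0 e; nra.
Qed.

(** Every tilt with [x] between [- L] and [L] is dominated by the sum of the two extreme tilts. *)
Lemma normal_pdf_le_envelope L : exists2 C, 0 <= C & forall x y, `|x| <= L ->
  normal_pdf x s y <= C * (normal_pdf L s y + normal_pdf (- L) s y).
Proof.
exists (damp L)^-1; first by rewrite invr_ge0 expR_ge0.
move=> x y xL; rewrite (normal_pdf_tilt x) (normal_pdf_tilt L).
rewrite (normal_pdf_tilt (- L)) sqrrN !mulNr.
set p := normal_pdf 0 s y; set w := y / _.
rewrite (_ : _^-1 * _ = p * (expR (L * w) + expR (- (L * w)))); last first.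
  by field; rewrite gt_eqF// expR_gt0.
rewrite -mulrA ler_wpM2l ?normal_pdf_ge0//.
apply: (@le_trans _ _ (expR (x * w))).
  rewrite ler_piMl ?expR_ge0// -[leRHS]expR0 ler_expR oppr_le0.
  by rewrite divr_ge0// ?sqr_ge0// mulrn_wge0// sqr_ge0.
exact: expRM_le_envelope.
Qed.

(** This makes the squared envelope integrable even after division by an output density. With E and
    F the tilts at [L] and [- L], multiply (E + F)^2 by e^(xw) (E + F) >= 1, then use (E + F)^3 <= 4
    (E^3 + F^3); the cubes are the tilts at [3 * L] and [- (3 * L)]. *)
Lemma normal_pdf_envelope_sqr L : exists2 C, 0 <= C & forall x y, `|x| <= L ->
  (normal_pdf L s y + normal_pdf (- L) s y) ^+ 2 <=
  C * normal_pdf x s y * (normal_pdf (3 * L) s y + normal_pdf (- (3 * L)) s y).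
Proof.
exists (4 * damp L / damp (3 * L)); first by rewrite divr_ge0 ?mulr_ge0 ?expR_ge0.
move=> x y xL; rewrite (normal_pdf_tilt x) (normal_pdf_tilt L) (normal_pdf_tilt (- L)).
rewrite (normal_pdf_tilt (3 * L)) (normal_pdf_tilt (- (3 * L))) !sqrrN !mulNr.
set p := normal_pdf 0 s y; set w := y / _.
have p0 : 0 <= p by exact: normal_pdf_ge0.
rewrite (_ : 3 * L * w = 3%:R * (L * w)) -1?[- (3%:R * _)]mulrN ?expRM_natl;
  last by rewrite mulrA.
set E := expR (L * w); set F := expR (- (L * w)).
have E0 : 0 < E by exact: expR_gt0.
have F0 : 0 < F by exact: expR_gt0.
have dL0 : 0 < damp L by exact: expR_gt0.
have hx : 1 <= expR (x * w) * (E + F).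
  have := @expRM_le_envelope R (- x) w L; rewrite normrN => /(_ xL).
  rewrite -/E -/F mulNr => h; rewrite -(expR0 R) -(subrr (x * w)) expRD.
  by rewrite ler_wpM2l ?expR_ge0.
have dx : damp L <= damp x.
  rewrite ler_expR lerN2 ler_wpM2r ?invr_ge0 ?mulrn_wge0 ?sqr_ge0//.
  by rewrite -(real_normK (num_real x)) lerXn2r ?nnegrE// (le_trans _ xL).
rewrite (_ : 4 * _ / _ * _ * _ = (4 * (E ^+ 3 + F ^+ 3)) *
    (p ^+ 2 * damp L * (damp x * expR (x * w)))); last first.
  by field; rewrite gt_eqF// expR_gt0.
rewrite [leLHS](_ : _ = (E + F) ^+ 2 * (p ^+ 2 * damp L ^+ 2)); last by ring.
apply: (@le_trans _ _ ((E + F) ^+ 3 * expR (x * w) * (p ^+ 2 * damp L ^+ 2))).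
  rewrite ler_wpM2r ?mulr_ge0 ?sqr_ge0// (exprSr _ 2) -[leRHS]mulrA ler_peMr ?sqr_ge0//.
  by rewrite mulrC.
rewrite [leLHS](_ : _ = (E + F) ^+ 3 *
    (p ^+ 2 * damp L * (damp L * expR (x * w)))); last by ring.
rewrite ler_pM ?exprn_ge0 ?addr_ge0 ?(ltW E0) ?(ltW F0)//.
- exact: mulr_ge0 (mulr_ge0 (sqr_ge0 _) (expR_ge0 _))
    (mulr_ge0 (expR_ge0 _) (expR_ge0 _)).
- rewrite -subr_ge0 [leRHS](_ : _ = 3 * (E + F) * (E - F) ^+ 2); last by ring.
  by rewrite mulr_ge0 ?sqr_ge0// mulr_ge0// addr_ge0// ltW.
- rewrite ler_wpM2l//; last by rewrite ler_wpM2r// expR_ge0.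
  exact: mulr_ge0 (sqr_ge0 _) (expR_ge0 _).
Qed.

(** The fourth power is absorbed by two exponentials, which tilt the centred density to the means 1
    and -1. *)
Lemma pow4_normal_pdf_le : exists2 C, 0 <= C & forall y,
  y ^+ 4 * normal_pdf 0 s y <= C * (normal_pdf 1 s y + normal_pdf (- 1) s y).
Proof.
exists ((s ^+ 2) ^+ 4 * 24 / damp 1).
  by rewrite divr_ge0 ?expR_ge0// mulr_ge0// exprn_ge0// sqr_ge0.
move=> y; rewrite [normal_pdf 1 _ _]normal_pdf_tilt [normal_pdf (- 1) _ _]normal_pdf_tilt.
rewrite !sqrrN !mulN1r !mul1r; set p := normal_pdf 0 s y; set w := y / _.
rewrite (_ : _ / _ * _ = (s ^+ 2) ^+ 4 * (24 * (expR w + expR (- w))) * p); last first.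
  by field; rewrite gt_eqF// expR_gt0.
rewrite ler_wpM2r ?normal_pdf_ge0//.
have -> : y = s ^+ 2 * w by rewrite /w; field.
rewrite exprMn ler_wpM2l//; last exact: pow4_le_expR.
by rewrite exprn_ge0// sqr_ge0.
Qed.

End gaussian_density_inequalities.

(** * Integrals of nonnegative real functions, and measurability *)

Section nonnegative_real_integrands.
Context d (T : measurableType d) (R : realType) (mu : {measure set T -> \bar R}).
Implicit Types f g : T -> R.

Lemma ge0_le_integral_EFin f g :
  measurable_fun [set: T] f -> measurable_fun [set: T] g ->
  (forall x, 0 <= f x) -> (forall x, f x <= g x) ->
  (\int[mu]_x (f x)%:E <= \int[mu]_x (g x)%:E)%E.
Proof.
move=> mf mg f0 fg; apply: ge0_le_integral => //.
- by move=> x _; rewrite lee_fin.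
- exact/measurable_EFinP.
- exact/measurable_EFinP.
- by move=> x _; rewrite lee_fin.
Qed.

Lemma ge0_integralD_EFin f g :
  measurable_fun [set: T] f -> measurable_fun [set: T] g ->
  (forall x, 0 <= f x) -> (forall x, 0 <= g x) ->
  (\int[mu]_x (f x + g x)%:E = \int[mu]_x (f x)%:E + \int[mu]_x (g x)%:E)%E.
Proof.
move=> mf mg f0 g0; rewrite -ge0_integralD//.
- by move=> x _; rewrite lee_fin.
- exact/measurable_EFinP.
- by move=> x _; rewrite lee_fin.
- exact/measurable_EFinP.
Qed.

Lemma ge0_integralZ_EFin k f : 0 <= k ->
  measurable_fun [set: T] f -> (forall x, 0 <= f x) ->
  (\int[mu]_x (k * f x)%:E = k%:E * \int[mu]_x (f x)%:E)%E.
Proof.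
move=> k0 mf f0; rewrite -ge0_integralZl_EFin//.
- by move=> x _; rewrite lee_fin.
- exact/measurable_EFinP.
Qed.

Lemma integral_EFin_ge0 f : (forall x, 0 <= f x) ->
  (0 <= \int[mu]_x (f x)%:E)%E.
Proof. by move=> f0; apply: integral_ge0 => x _; rewrite lee_fin. Qed.

End nonnegative_real_integrands.

Lemma integral_probability_cst d (T : measurableType d) (R : realType)
    (P : probability T R) (r : R) : (\int[P]_t r%:E = r%:E)%E.
Proof.
rewrite integral_cst// -[RHS]mule1; congr (_ * _)%E; exact: probability_setT.
Qed.

Section measurability.
Context d (T : measurableType d) (R : realType).

Lemma measurable_mfun_comp (h : {mfun R >-> R}) (f : T -> R) :
  measurable_fun [set: T] f -> measurable_fun [set: T] (fun t => h (f t)).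
Proof. by move=> mf; apply: measurableT_comp. Qed.

(** Joint measurability in mean and argument holds because the density depends only on their
    difference. *)
Lemma measurable_normal_pdf_comp (s : R) (c f : T -> R) : s != 0 ->
  measurable_fun [set: T] c -> measurable_fun [set: T] f ->
  measurable_fun [set: T] (fun t => normal_pdf (c t) s (f t)).
Proof.
move=> s0 mc mf; rewrite (_ : (fun t => _) =
    (fun t => normal_pdf 0 s (f t - c t))); last first.
  apply/funext => t; rewrite !normal_pdfE//.
  by rewrite [in LHS]normal_fun_center.
apply: (@measurableT_comp _ _ _ _ _ _ (normal_pdf 0 s)).
  exact: measurable_normal_pdf.
exact: measurable_funB.
Qed.

End measurability.

Definition policy_of {R : realType} (f : R -> R)
    (mf : measurable_fun [set: R] f) : policy R :=
  let mixin := isMeasurableFun.Build _ _ _ _ _ mf in HB.pack f mixin.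

Ltac measurability := repeat first
  [ exact: measurable_cst | exact: measurable_id
  | exact: measurable_fst | exact: measurable_snd
  | exact: measurable_funPT | assumption
  | apply: measurable_normal_pdf_comp => //
  | apply: measurable_mfun_comp
  | apply: measurable_indic => //
  | apply: measurable_funX | apply: measurable_funM | apply: measurable_funB
  | apply: measurable_funD | apply: measurable_funN ].


Ltac nonnegativity := move=> *; repeat first
  [ exact: sqr_ge0 | exact: normal_pdf_ge0 | done
  | apply: mulr_ge0 | apply: addr_ge0 ].

(** * Symmetry, scaling and moments of centred Gaussian laws *)

Section gaussian_moments.
Context {R : realType}.
Local Notation mu := (@lebesgue_measure R).

Lemma normal_pdfN (s x : R) : s != 0 -> normal_pdf 0 s (- x) = normal_pdf 0 s x.
Proof. by move=> s0; rewrite !normal_pdfE// /normal_fun !subr0 sqrrN. Qed.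

Lemma ge0_integral_normal_probN (s : R) (f : R -> \bar R) : s != 0 ->
  measurable_fun [set: R] f -> (forall x, 0 <= f x)%E ->
  (\int[normal_prob 0 s]_x f x = \int[normal_prob 0 s]_x f (- x)%R)%E.
Proof.
move=> s0 mf f0.
have mfN : measurable_fun [set: R] (fun x => f (- x)).
  by apply: (measurableT_comp mf); exact: oppr_measurable.
have mpdf : measurable_fun [set: R] (fun x => (normal_pdf 0 s x)%:E).
  by apply/measurable_EFinP; exact: measurable_normal_pdf.
rewrite (ge0_integral_normal_prob 0 s mf f0).
rewrite (ge0_integral_normal_prob 0 s mfN (fun x => f0 _)) ge0_integral_opp.
- by apply: eq_integral => x _; rewrite normal_pdfN.
- exact: emeasurable_funM.
- by move=> x; rewrite mule_ge0// lee_fin normal_pdf_ge0.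
Qed.

Lemma normal_pdf_standardize (s x : R) : 0 < s ->
  normal_pdf 0 s x = normal_pdf 0 1 (x / s) / s.
Proof.
move=> s0; rewrite !normal_pdfE ?gt_eqF// /normal_peak /normal_fun !subr0.
rewrite expr1n mul1r -mulrnAr sqrtrM ?sqr_ge0// sqrtr_sqr gtr0_norm//.
rewrite invfM [RHS]mulrAC [s^-1 * _]mulrC; congr (_ * expR _).
by field; rewrite gt_eqF.
Qed.

(** Substitution of [x / s]. Only the scaling in [s] matters below: the second moment of the
    standard normal stays an unspecified positive constant [k]. *)
Lemma second_moment_normal_prob (s : R) : 0 < s ->
  (\int[normal_prob 0 s]_x (x ^+ 2)%:E =
   (s ^+ 2)%:E * \int[normal_prob 0 1]_x (x ^+ 2)%:E)%E.
Proof.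
move=> s0; have sn0 : s != 0 by rewrite gt_eqF.
have mX2 : measurable_fun [set: R] (fun x : R => (x ^+ 2)%:E).
  by apply/measurable_EFinP; exact: measurable_funX.
rewrite !ge0_integral_normal_prob//; [|by move=> x; rewrite lee_fin sqr_ge0..].
pose F (x : R) := x / s; pose G (y : R) := y ^+ 2 * normal_pdf 0 1 y.
have F'E : F^`()%classic = cst s^-1.
  apply/funext => x.
  by rewrite derive1E deriveM// derive_cst scaler0 add0r derive_id scaler1.
under [X in (_ * X)%E]eq_integral do rewrite -EFinM.
rewrite (@increasing_ge0_integration_by_substitutionT R F G); first last.
- by move=> x; rewrite mulr_ge0 ?sqr_ge0 ?normal_pdf_ge0.
- move=> x; apply: cvgM; first exact: sqr_continuous.
  exact: continuous_normal_pdf.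
- by apply: gt0_cvgMly; [rewrite invr_gt0|exact: cvg_id].
- by apply: gt0_cvgMlNy; [rewrite invr_gt0|exact: cvg_id].
- by move=> x; apply: derivableM.
- by rewrite F'E; exact: is_cvg_cst.
- by rewrite F'E; exact: is_cvg_cst.
- by rewrite F'E => x; exact: cvg_cst.
- by move=> x y xy; rewrite ltr_pM2r ?invr_gt0.
rewrite -ge0_integralZl_EFin ?sqr_ge0//; first last.
- rewrite F'E; apply/measurable_EFinP; apply: measurable_funM => //.
  apply: measurable_funM; first exact/measurable_funX/measurable_funM.
  apply: (@measurableT_comp _ _ _ _ _ _ (normal_pdf 0 1)).
    exact: measurable_normal_pdf.
  exact: measurable_funM.
- move=> x _; rewrite F'E lee_fin -[leRHS]/(G (F x) * s^-1).
  by rewrite mulr_ge0 ?invr_ge0 ?(ltW s0)// mulr_ge0 ?sqr_ge0 ?normal_pdf_ge0.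
apply: eq_integral => x _; rewrite F'E -!EFinM normal_pdf_standardize//.
rewrite -[((G \o F) * _) x]/((x / s) ^+ 2 * normal_pdf 0 1 (x / s) * s^-1).
by congr (_%:E); field.
Qed.

Lemma fourth_moment_normal_prob_lty (s : R) : s != 0 ->
  (\int[normal_prob 0 s]_x (x ^+ 4)%:E < +oo)%E.
Proof.
move=> s0; have [C C0 hC] := pow4_normal_pdf_le s0.
rewrite ge0_integral_normal_prob; first last.
- by move=> x; rewrite lee_fin (exprM _ 2 2) sqr_ge0.
- by apply/measurable_EFinP; exact: measurable_funX.
under eq_integral do rewrite -EFinM.
apply: (@le_lt_trans _ _
    (\int[mu]_x (C * (normal_pdf 1 s x + normal_pdf (- 1) s x))%:E)%E).
  apply: ge0_le_integral_EFin => //.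
  - by measurability.
  - by measurability.
  - by move=> x; rewrite mulr_ge0 ?normal_pdf_ge0// (exprM _ 2 2) sqr_ge0.
rewrite ge0_integralZ_EFin//; last 2 first.
- by measurability.
- by move=> x; rewrite addr_ge0// normal_pdf_ge0.
rewrite ge0_integralD_EFin//; last 4 first.
- by measurability.
- by measurability.
- by move=> x; exact: normal_pdf_ge0.
- by move=> x; exact: normal_pdf_ge0.
by rewrite !integral_normal_pdf -EFinD -EFinM ltry.
Qed.

End gaussian_moments.

(** * Gaussian channel *)

Section tonelli.
Context {R : realType}.
Variables m1 m2 : {sigma_finite_measure set (measurableTypeR R) -> \bar R}.
Variable f : R * R -> R.
Hypotheses (mf : measurable_fun [set: R * R] f) (f0 : forall z, 0 <= f z).

Lemma tonelli1_EFin :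
  (\int[(m1 \x m2)%E]_z (f z)%:E = \int[m1]_x \int[m2]_y (f (x, y))%:E)%E.
Proof.
apply: (@fubini_tonelli1 _ _ _ _ _ m1 m2 (EFin \o f)).
- exact/measurable_EFinP.
- by move=> z; rewrite lee_fin.
Qed.

Lemma tonelli2_EFin :
  (\int[(m1 \x m2)%E]_z (f z)%:E = \int[m2]_y \int[m1]_x (f (x, y))%:E)%E.
Proof.
apply: (@fubini_tonelli2 _ _ _ _ _ m1 m2 (EFin \o f)).
- exact/measurable_EFinP.
- by move=> z; rewrite lee_fin.
Qed.

Lemma measurable_section1 (x : R) : measurable_fun [set: R] (fun y => f (x, y)).
Proof. exact: (measurableT_comp mf (pair1_measurable x)). Qed.

Lemma measurable_section2 (y : R) : measurable_fun [set: R] (fun x => f (x, y)).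
Proof. exact: (measurableT_comp mf (pair2_measurable y)). Qed.

Lemma measurable_integral_section2 :
  measurable_fun [set: R] (fun y => \int[m1]_x (f (x, y))%:E)%E.
Proof.
apply: (@measurable_fun_fubini_tonelli_G _ _ _ _ _ m1 (EFin \o f)).
- exact/measurable_EFinP.
- by move=> z; rewrite lee_fin.
Qed.

End tonelli.

Section gaussian_channel.
Context d (T : measurableType d) (R : realType) (P : probability T R).
Variables (m w : {RV P >-> R}) (sm sw : R).
Hypotheses (sm0 : 0 < sm) (sw0 : 0 < sw).
Hypothesis gaussian : gaussian_source_and_noise m w sm sw.
Local Notation mu := (@lebesgue_measure R).
Local Notation N := (normal_prob 0 sm).

Let smn0 : sm != 0. Proof. by rewrite gt_eqF. Qed.
Let swn0 : sw != 0. Proof. by rewrite gt_eqF. Qed.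

Lemma source_noise_integral (f : R * R -> R) :
  measurable_fun [set: R * R] f -> (forall z, 0 <= f z) ->
  (\int[P]_t (f (m t, w t))%:E =
   \int[(N \x normal_prob 0 sw)%E]_z (f z)%:E)%E.
Proof.
case: gaussian => mN wN indep mf f0.
apply: (independent_RV_ge0_integral mN wN indep (f := EFin \o f)).
- exact/measurable_EFinP.
- by move=> z; rewrite lee_fin.
Qed.

Lemma source_integral (f : R -> R) :
  measurable_fun [set: R] f -> (forall x, 0 <= f x) ->
  (\int[P]_t (f (m t))%:E = \int[N]_x (f x)%:E)%E.
Proof.
case: gaussian => mN _ _ mf f0.
pose X t : measurableTypeR R := m t.
have mX : measurable_fun [set: T] X by exact: (measurable_funPT m).
rewrite -(ge0_integral_pushforward mX (D := setT) P (f := EFin \o f))//.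
- by apply: eq_measure_integral => A mA _; exact: mN.
- exact/measurable_EFinP.
- by move=> x _; rewrite lee_fin.
Qed.

Lemma noise_integral (f : R -> R) :
  measurable_fun [set: R] f -> (forall x, 0 <= f x) ->
  (\int[P]_t (f (w t))%:E = \int[normal_prob 0 sw]_x (f x)%:E)%E.
Proof.
case: gaussian => _ wN _ mf f0.
pose X t : measurableTypeR R := w t.
have mX : measurable_fun [set: T] X by exact: (measurable_funPT w).
rewrite -(ge0_integral_pushforward mX (D := setT) P (f := EFin \o f))//.
- by apply: eq_measure_integral => A mA _; exact: wN.
- exact/measurable_EFinP.
- by move=> x _; rewrite lee_fin.
Qed.

(** With the noise fixed, the centred Gaussian source is symmetric. This later removes cross terms
    without integrating signed functions. *)
Lemma source_symmetry (f : R * R -> R) :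
  measurable_fun [set: R * R] f -> (forall z, 0 <= f z) ->
  (\int[P]_t (f (m t, w t))%:E = \int[P]_t (f (- m t, w t))%:E)%E.
Proof.
move=> mf f0.
have mfN : measurable_fun [set: R * R] (fun z => f (- z.1, z.2)).
  apply: measurableT_comp => //; apply/measurable_fun_pairP; split.
    by apply: measurable_funN; exact: measurable_fst.
  exact: measurable_snd.
have /= -> := source_noise_integral mfN (fun z => f0 _).
rewrite source_noise_integral//.
rewrite !tonelli2_EFin//; apply: eq_integral => v _.
rewrite ge0_integral_normal_probN//.
- by apply/measurable_EFinP; exact: (measurable_section2 mf).
- by move=> x; rewrite lee_fin.
Qed.

(* The pair (source, channel output) has density [normal_pdf (ge a) sw y] with
   respect to the product of the source law and the Lebesgue measure. *)
Lemma source_output_integral (ge : policy R) (K : R * R -> R) :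
  measurable_fun [set: R * R] K -> (forall z, 0 <= K z) ->
  (\int[P]_t (K (m t, ge (m t) + w t)%R)%:E =
   \int[(N \x mu)%E]_z (K z * normal_pdf (ge z.1) sw z.2)%:E)%E.
Proof.
move=> mK K0.
have mKs : measurable_fun [set: R * R] (fun z => K (z.1, ge z.1 + z.2)).
  apply: measurableT_comp => //; apply/measurable_fun_pairP; split.
    exact: measurable_fst.
  by apply: measurable_funD; measurability.
have mKp : measurable_fun [set: R * R]
    (fun z => K z * normal_pdf (ge z.1) sw z.2) by measurability.
have Kp0 z : 0 <= K z * normal_pdf (ge z.1) sw z.2.
  by rewrite mulr_ge0// normal_pdf_ge0.
have /= -> := source_noise_integral mKs (fun z => K0 _).
rewrite !tonelli1_EFin//; apply: eq_integral => a _ /=.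
rewrite ge0_integral_normal_prob//.
(* For a fixed source value, translation by the channel input turns the output variable back into
   the noise. *)
- rewrite [RHS](ge0_integral_translation (ge a)).
  + apply: eq_integral => v _; rewrite -EFinM [(v + _)%R]addrC.
    by rewrite !normal_pdfE// /normal_fun subr0 [(ge a + v - _)%R]addrAC subrr add0r.
  + apply/measurable_EFinP; exact: (measurable_section1 mKp).
  + by move=> y; rewrite lee_fin.
- apply/measurable_EFinP; exact: (measurable_section1 mKs).
- by move=> y; rewrite lee_fin.
Qed.

End gaussian_channel.

(** * Costs of the game *)

(** A vanishing integral would force [f] to be zero almost everywhere, against its positivity on a
    set of positive measure. *)
Lemma ge0_integral_gt0 d (T : measurableType d) (R : realType)
    (mu : {measure set T -> \bar R}) (f : T -> \bar R) (A : set T) :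
  measurable_fun [set: T] f -> (forall x, 0 <= f x)%E ->
  measurable A -> (0 < mu A)%E -> (forall x, A x -> 0 < f x)%E ->
  (0 < \int[mu]_x f x)%E.
Proof.
move=> mf f0 mA A0 fA; rewrite lt_neqAle integral_ge0// andbT eq_sym.
apply: contraTneq A0 => intf0.
have /(ae_eq_integral_abs _ measurableT mf)[B [mB B0 fB]] :
    (\int[mu]_x `|f x| = 0)%E.
  by rewrite -intf0; apply: eq_integral => x _; rewrite gee0_abs.
rewrite -leNgt -B0 le_measure ?inE// => x Ax; apply: fB => /=.
by move=> /(_ Logic.I) fx0; have := fA _ Ax; rewrite fx0 ltxx.
Qed.

Lemma ge0_lty_EFin (R : realType) (x : \bar R) : (0 <= x)%E -> (x < +oo)%E ->
  exists2 r : R, 0 <= r & x = r%:E.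
Proof. by case: x => // r; rewrite lee_fin => r0 _; exists r. Qed.

Section game_costs.
Context d (T : measurableType d) (R : realType) (P : probability T R).
Variables (m w : {RV P >-> R}).
Implicit Types (ge gd : policy R) (b lambda : R).

Lemma decoder_costE ge gd : decoder_cost m w ge gd =
  (\int[P]_t ((m t - gd (ge (m t) + w t)) ^+ 2)%:E)%E.
Proof. by rewrite /decoder_cost unlock. Qed.

Lemma encoder_costE b lambda ge gd : 0 <= lambda ->
  encoder_cost m w b lambda ge gd =
  (\int[P]_t ((m t - gd (ge (m t) + w t)  - b) ^+ 2)%:E +
   \int[P]_t (lambda * ge (m t) ^+ 2)%:E)%E.
Proof.
move=> l0; rewrite -ge0_integralD_EFin.
- by rewrite /encoder_cost unlock.
- by measurability.
- by measurability.
- by move=> t; rewrite sqr_ge0.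
- by move=> t; rewrite mulr_ge0// sqr_ge0.
Qed.

Lemma decoder_cost_ge0 ge gd : (0 <= decoder_cost m w ge gd)%E.
Proof. by rewrite decoder_costE integral_EFin_ge0// => t; rewrite sqr_ge0. Qed.

Lemma encoder_cost_ge0 b lambda ge gd : 0 <= lambda ->
  (0 <= encoder_cost m w b lambda ge gd)%E.
Proof.
move=> l0; rewrite encoder_costE// adde_ge0// integral_EFin_ge0// => t.
  by rewrite sqr_ge0.
by rewrite mulr_ge0// sqr_ge0.
Qed.

Lemma total_cost_unbiasedE lambda ge gd : 0 <= lambda ->
  total_cost m w 0 lambda ge gd =
  (2%:E * decoder_cost m w ge gd + \int[P]_t (lambda * ge (m t) ^+ 2)%:E)%E.
Proof.
move=> l0; rewrite /total_cost encoder_costE// decoder_costE.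
under eq_integral do rewrite subr0.
by rewrite -[2%:E]/((1 + 1)%R%:E) EFinD ge0_muleDl ?lee_fin// !mul1e addeAC.
Qed.

Lemma social_cost_le b lambda ge gd :
  (social_cost m w b lambda <= total_cost m w b lambda ge gd)%E.
Proof. by apply: ereal_inf_lbound; exists (ge, gd). Qed.

Lemma social_cost_ge0 b lambda : 0 <= lambda ->
  (0 <= social_cost m w b lambda)%E.
Proof.
move=> l0; apply: le_ereal_inf_tmp => _ [g _ <-].
by rewrite adde_ge0 ?encoder_cost_ge0 ?decoder_cost_ge0.
Qed.

(* The decoder optimality against [gd + b / 4] forces
   [E (D - b)^2 >= E D^2 + 3 b^2 / 4] for [D = m - u], while [gd - b / 2]
   brings the total cost down to [2 E D^2 + b^2 / 2]. *)
Lemma social_cost_lt_biased b lambda ge gd : 0 <= lambda -> b != 0 ->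
  nash_equilibrium m w b lambda ge gd ->
  (total_cost m w b lambda ge gd < +oo)%E ->
  (social_cost m w b lambda < total_cost m w b lambda ge gd)%E.
Proof.
move=> l0 b0 [_ nashd] Tfin.
pose D t := m t - gd (ge (m t) + w t).
have mD : measurable_fun [set: T] D by rewrite /D; measurability.
pose I c := (\int[P]_t ((D t - c) ^+ 2)%:E)%E.
have I0 c : (0 <= I c)%E by apply: integral_EFin_ge0 => t; rewrite sqr_ge0.
(* Quadratic identities are transferred to expectations as equalities between sums of nonnegative
   terms, so no subtraction of possibly infinite integrals occurs. *)
have Icomb k1 c1 k2 c2 k3 : 0 <= k1 -> 0 <= k2 -> 0 <= k3 ->
    (k1%:E * I c1 + k2%:E * I c2 + k3%:E =
     \int[P]_t (k1 * (D t - c1) ^+ 2 + k2 * (D t - c2) ^+ 2 + k3)%:E)%E.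
  move=> k10 k20 k30.
  have kD0 k c t : 0 <= k -> 0 <= k * (D t - c) ^+ 2.
    by move=> k0; rewrite mulr_ge0// sqr_ge0.
  rewrite !ge0_integralD_EFin//; try by [measurability|move=> t; rewrite ?addr_ge0 ?kD0].
  rewrite !ge0_integralZ_EFin//; try by [measurability|move=> t; rewrite sqr_ge0].
  by rewrite integral_probability_cst.
pose shift (c : R) (x : R) := gd x + c.
have mshift c : measurable_fun [set: R] (shift c) by rewrite /shift; measurability.
have dE c : decoder_cost m w ge (policy_of (mshift c)) = I c.
  by rewrite decoder_costE; apply: eq_integral => t _; rewrite /= /shift opprD addrA.
have eE c : encoder_cost m w b lambda ge (policy_of (mshift c)) =
    (I (c + b)%R + \int[P]_t (lambda * ge (m t) ^+ 2)%:E)%E.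
  rewrite encoder_costE//; congr (_ + _)%E; apply: eq_integral => t _.
  by rewrite /= /shift /D; congr (_ ^+ 2)%:E; ring.
have gdE : decoder_cost m w ge gd = I 0.
  by rewrite decoder_costE; apply: eq_integral => t _; rewrite subr0.
have geE : encoder_cost m w b lambda ge gd =
    (I b + \int[P]_t (lambda * ge (m t) ^+ 2)%:E)%E by rewrite encoder_costE.
have := nashd (policy_of (mshift (b / 4))); rewrite gdE dE => nash4.
apply: (le_lt_trans (social_cost_le b lambda ge (policy_of (mshift (- (b / 2)))))).
move: Tfin; rewrite /total_cost eE dE geE gdE.
set X := (\int[P]_t (lambda * _)%:E)%E.
have X0 : (0 <= X)%E.
  by apply: integral_EFin_ge0 => t; rewrite mulr_ge0// sqr_ge0.
(* With [I 0 <= I (b / 4)] this yields [I b >= I 0 + 3 b^2 / 4]; [E2] is the parallelogram identity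
   for the errors shifted by [b / 2] and [- b / 2]. *)
have E4 : (1%:E * I b + 4%:E * I 0%R + (b ^+ 2 / 4)%:E =
           4%:E * I (b / 4)%R + 1%:E * I 0%R + (b ^+ 2)%:E)%E.
  rewrite !Icomb ?divr_ge0 ?sqr_ge0//.
  by apply: eq_integral => t _; congr (_%:E); field.
have E2 : (1%:E * I (- (b / 2) + b)%R + 1%:E * I (- (b / 2))%R + 0%:E =
           2%:E * I 0%R + 0%:E * I 0%R + (b ^+ 2 / 2)%:E)%E.
  rewrite !Icomb ?divr_ge0 ?sqr_ge0//.
  by apply: eq_integral => t _; congr (_%:E); field.
have b2 : 0 < b ^+ 2 by rewrite exprn_even_gt0.
move=> Tfin; have : (I b + X + I 0%R)%E \is a fin_num.
  by rewrite ge0_fin_numE//; exact: adde_ge0 (adde_ge0 (I0 _) X0) (I0 _).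
rewrite (fin_numD (I b + X)%E) (fin_numD (I b)) {Tfin} => /andP[/andP[]].
move: X0 (I0 b) (I0 0) (I0 (b / 4)) (I0 (- (b / 2) + b)) (I0 (- (b / 2))) E4 E2 nash4.
case: X => // x x0; case: (I b) => // ib ib0; case: (I 0) => // i0 i00.
(* An infinite [I (b / 4)] contradicts [E4], whose left side is finite here. *)
case: (I (b / 4)) => // [i4 _|_]; last first.
  by rewrite gt0_muley ?lte_fin// -!EFinM -!EFinD !addye.
case: (I (- (b / 2) + b)) => // [j1|] _; case: (I (- (b / 2))) => // [j2|] _;
  rewrite ?mul1e -?EFinM -?EFinD// => -[E4].
case=> E2; rewrite !lee_fin !lte_fin => nash4 _ _ _.
move: (b ^+ 2) b2 E4 E2 => bb bb0 E4 E2; lra.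
Qed.

End game_costs.

(** * Positivity and finiteness of the costs, and the case without power cost *)

Section gaussian_game.
Context d (T : measurableType d) (R : realType) (P : probability T R).
Variables (m w : {RV P >-> R}) (sm sw : R).
Hypotheses (sm0 : 0 < sm) (sw0 : 0 < sw).
Hypothesis gaussian : gaussian_source_and_noise m w sm sw.
Local Notation mu := (@lebesgue_measure R).
Local Notation N := (normal_prob 0 sm).
Implicit Types (ge gd : policy R) (b lambda : R).

Let smn0 : sm != 0. Proof. by rewrite gt_eqF. Qed.
Let swn0 : sw != 0. Proof. by rewrite gt_eqF. Qed.

Let itv01_gt0 : (0 < mu `]0%R, 1%R[%classic)%E.
Proof. by rewrite lebesgue_measure_itv/= lte01 sube0 lte01. Qed.

(** Positivity comes from the interval between 0 and 1, finiteness from x^2 <= 1 + x^4. *)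
Lemma normal_prob01_second_moment : exists2 k : R, 0 < k &
  (\int[normal_prob 0 1]_x (x ^+ 2)%:E = k%:E :> \bar R)%E.
Proof.
have X2 : measurable_fun [set: R] (fun x : R => x ^+ 2) by measurability.
have pos : (0 < \int[normal_prob 0 1]_x ((x : R) ^+ 2)%:E)%E.
  rewrite ge0_integral_normal_prob//; last 2 first.
  - exact/measurable_EFinP.
  - by move=> x; rewrite lee_fin sqr_ge0.
  apply: (@ge0_integral_gt0 _ _ _ mu _ `]0, 1[%classic) => //.
  - apply: emeasurable_funM; first exact/measurable_EFinP.
    by apply/measurable_EFinP; exact: measurable_normal_pdf.
  - by move=> x; rewrite mule_ge0// lee_fin ?sqr_ge0 ?normal_pdf_ge0.
  - move=> x /=; rewrite in_itv/= => /andP[x0 _].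
    by rewrite -EFinM lte_fin mulr_gt0 ?exprn_gt0 ?normal_pdf_gt0.
have fin : (\int[normal_prob 0 1]_x ((x : R) ^+ 2)%:E < +oo)%E.
  apply: (@le_lt_trans _ _ (\int[normal_prob 0 1]_x (1 + (x : R) ^+ 4)%:E)%E).
    apply: ge0_le_integral_EFin => //.
    - by measurability.
    - by move=> x; rewrite sqr_ge0.
    - move=> x; rewrite (exprM _ 2 2); have := sqr_ge0 (x ^+ 2 - 1).
      by move: (x ^+ 2) => y; rewrite !expr2; nra.
  rewrite ge0_integralD_EFin//; try by measurability.
    2: by move=> x; rewrite (exprM _ 2 2) sqr_ge0.
  rewrite lte_add_pinfty ?fourth_moment_normal_prob_lty ?oner_eq0//.
  by rewrite integral_probability_cst ltry.
have [k k0 kE] := ge0_lty_EFin (ltW pos) fin.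
by exists k => //; rewrite -lte_fin -kE.
Qed.

Lemma source_fourth_moment_lty : (\int[P]_t (m t ^+ 4)%:E < +oo)%E.
Proof.
rewrite (source_integral gaussian (f := fun x => x ^+ 4)).
- exact: fourth_moment_normal_prob_lty.
- by measurability.
- by move=> x; rewrite (exprM _ 2 2) sqr_ge0.
Qed.

Lemma second_moments : exists2 k : R, 0 < k &
  (\int[P]_t (m t ^+ 2)%:E = (k * sm ^+ 2)%:E)%E /\
  (\int[P]_t (w t ^+ 2)%:E = (k * sw ^+ 2)%:E)%E.
Proof.
have [k k0 kE] := normal_prob01_second_moment; exists k => //; split.
- rewrite (source_integral gaussian (f := fun x => x ^+ 2)).
  + by rewrite second_moment_normal_prob// kE -EFinM mulrC.
  + by measurability.
  + by move=> x; rewrite sqr_ge0.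
- rewrite (noise_integral gaussian (f := fun x => x ^+ 2)).
  + by rewrite second_moment_normal_prob// kE -EFinM mulrC.
  + by measurability.
  + by move=> x; rewrite sqr_ge0.
Qed.

(** Given any output [y], the atomless source misses the value [gd y] almost surely, and the
    conditional density of the output is positive everywhere. No decoder is therefore exact. *)
Lemma decoder_cost_gt0 ge gd : (0 < decoder_cost m w ge gd)%E.
Proof.
pose K (z : R * R) := (z.1 - gd z.2) ^+ 2.
have mK : measurable_fun [set: R * R] K by rewrite /K; measurability.
have K0 z : 0 <= K z by rewrite sqr_ge0.
pose H (z : R * R) := K z * normal_pdf (ge z.1) sw z.2.
have mH : measurable_fun [set: R * R] H by rewrite /H; measurability.
have H0 z : 0 <= H z by rewrite mulr_ge0 ?normal_pdf_ge0.
rewrite decoder_costE -[X in (_ < X)%E]/(\int[P]_t (K (m t, ge (m t) + w t)%R)%:E)%E.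
rewrite (source_output_integral sw0 gaussian)// tonelli2_EFin//.
apply: (@ge0_integral_gt0 _ _ _ mu _ `]0, 1[%classic) => //.
- exact: (measurable_integral_section2 _ mH H0).
- by move=> y; apply: integral_EFin_ge0 => a; exact: H0.
move=> y _; apply: (@ge0_integral_gt0 _ _ _ N _ (~` [set gd y])) => //.
- by apply/measurable_EFinP; exact: (measurable_section2 mH).
- by move=> x; rewrite lee_fin H0.
- exact: measurableC.
- have N1 : N [set gd y] = 0%E.
    have /null_content_dominatesP := normal_prob_dominates (0 : R) sm.
    apply; [exact: measurable_set1|exact: lebesgue_measure_set1].
  have NC := probability_setC (normal_prob 0 sm : probability _ R)
    (measurable_set1 (gd y)).
  rewrite [X in (_ < X)%E]NC -[X in (_ < X)%E]/(1 - N [set gd y])%E.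
  by rewrite N1 sube0.
- move=> a /= agd; rewrite lte_fin mulr_gt0 ?normal_pdf_gt0// exprn_even_gt0//=.
  by rewrite subr_eq0; exact/eqP.
Qed.

Lemma social_cost_lty b lambda : 0 <= lambda ->
  (social_cost m w b lambda < +oo)%E.
Proof.
move=> l0; pose z : policy R := policy_of (@measurable_cst _ _ R R setT 0).
apply: (le_lt_trans (social_cost_le m w b lambda z z)).
have [k k0 [kE _]] := second_moments.
have mfin (c : R) : (\int[P]_t ((m t - 0 - c) ^+ 2)%:E < +oo)%E.
  apply: (@le_lt_trans _ _ (\int[P]_t (2 * m t ^+ 2 + 2 * c ^+ 2)%:E)%E).
    apply: ge0_le_integral_EFin.
    - by measurability.
    - by measurability.
    - by move=> t; rewrite sqr_ge0.
    - by move=> t; have := sqr_ge0 (m t + c); rewrite !expr2; nra.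
  rewrite ge0_integralD_EFin//; try by [measurability|move=> t; rewrite mulr_ge0// sqr_ge0].
  rewrite ge0_integralZ_EFin//; try by [measurability|move=> t; rewrite sqr_ge0].
  rewrite kE -EFinM lte_add_pinfty ?ltry//.
  by rewrite integral_probability_cst ltry.
rewrite /total_cost encoder_costE// decoder_costE.
apply: lte_add_pinfty; first apply: lte_add_pinfty.
- exact: mfin.
- by under eq_integral do rewrite /= expr0n mulr0; rewrite integral0 ltry.
- by have := mfin 0; under eq_integral do rewrite subr0.
Qed.

(* Signalling [k m] and decoding [y / k] leaves only the error [w / k]. *)
Lemma social_cost_lt_unpowered ge gd :
  (total_cost m w 0 0 ge gd < +oo)%E ->
  (social_cost m w 0 0 < total_cost m w 0 0 ge gd)%E.
Proof.
move=> Tfin; have [k k0 [_ kE]] := second_moments.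
have := total_cost_unbiasedE m w ge gd (lexx 0).
have X0 (h : policy R) : (\int[P]_t (0 * h (m t) ^+ 2)%:E = 0)%E.
  by under eq_integral do rewrite mul0r; rewrite integral0.
rewrite X0 adde0 => TE.
have := decoder_cost_gt0 ge gd; move: Tfin; rewrite TE => Tfin J0.
have [j j0 jE] : exists2 j : R, 0 < j & decoder_cost m w ge gd = j%:E.
  case: (decoder_cost m w ge gd) Tfin J0 => [j _ j0|+ _|//].
    by exists j.
  by rewrite gt0_muley.
(* The gain [q] makes the residual error W / q^2 smaller than [j]: [j * q = W + j > W] and
   [q >= 1]. *)
pose W := k * sw ^+ 2; pose q := W / j + 1.
have W0 : 0 <= W by rewrite mulr_ge0 ?sqr_ge0// ltW.
have q1 : 1 <= q by rewrite lerDr divr_ge0// ltW.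
have mq : measurable_fun [set: R] (fun x : R => q * x) by measurability.
have mq' : measurable_fun [set: R] (fun x : R => q^-1 * x) by measurability.
apply: (le_lt_trans (social_cost_le m w 0 0 (policy_of mq) (policy_of mq'))).
rewrite total_cost_unbiasedE// X0 adde0 jE -EFinM decoder_costE.
have qn0 : q != 0 by rewrite gt_eqF// (lt_le_trans _ q1).
under eq_integral => t _.
  rewrite /= (_ : (_ - _) ^+ 2 = (q ^+ 2)^-1 * w t ^+ 2); last by field.
  over.
rewrite ge0_integralZ_EFin ?invr_ge0 ?sqr_ge0//;
  try by [measurability|move=> t; rewrite sqr_ge0].
rewrite kE -/W -!EFinM lte_fin ltr_pM2l// mulrC ltr_pdivrMr ?exprn_even_gt0//.
have : j * q = W + j by rewrite /q mulrDr mulr1 mulrC divfK// gt_eqF.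
by rewrite expr2; nra.
Qed.

End gaussian_game.

(** * Silent encoders and weak linear signalling *)

Section uninformative_equilibrium.
Context d (T : measurableType d) (R : realType) (P : probability T R).
Variables (m w : {RV P >-> R}) (sm sw : R).
Hypotheses (sm0 : 0 < sm) (sw0 : 0 < sw).
Hypothesis gaussian : gaussian_source_and_noise m w sm sw.
Implicit Types (ge gd : policy R) (lambda : R).

(** Averaging over the reflection of the source discards the part of [f] that is odd in the
    source. *)
Lemma source_symmetrization (f g : R * R -> R) :
  measurable_fun [set: R * R] f -> (forall z, 0 <= f z) ->
  (forall a v, f (a, v) + f (- a, v) = 2 * g (a, v)) ->
  (\int[P]_t (f (m t, w t))%:E = \int[P]_t (g (m t, w t))%:E)%E.
Proof.
move=> mf f0 fg.
have mfmw : measurable_fun [set: T] (fun t => f (m t, w t)).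
  apply: measurableT_comp => //; apply/measurable_fun_pairP.
  by split; [exact: (measurable_funPT m)|exact: (measurable_funPT w)].
have mfNmw : measurable_fun [set: T] (fun t => f (- m t, w t)).
  apply: measurableT_comp => //; apply/measurable_fun_pairP.
  by split; [apply: measurable_funN; exact: (measurable_funPT m)|
             exact: (measurable_funPT w)].
pose f' t := 2^-1 * f (m t, w t); pose f'' t := 2^-1 * f (- m t, w t).
transitivity (\int[P]_t (f' t + f'' t)%:E)%E; last first.
  apply: eq_integral => t _; rewrite /f' /f'' -mulrDr fg; congr (_%:E).
  by field.
have h0 : 0 <= 2^-1 :> R by [].
rewrite ge0_integralD_EFin; last 4 first.
- by rewrite /f'; measurability.
- by rewrite /f''; measurability.
- by move=> t; rewrite mulr_ge0.
- by move=> t; rewrite mulr_ge0.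
rewrite !ge0_integralZ_EFin//.
rewrite -(source_symmetry sm0 gaussian mf f0) -ge0_muleDl ?lee_fin//.
by rewrite -EFinD (_ : 2^-1 + 2^-1 = 1) ?mul1e//; field.
Qed.

(** The cross term is odd in the source, so symmetrization removes it. *)
Lemma second_moment_linear_combination (k A B : R) :
  (\int[P]_t (m t ^+ 2)%:E = (k * sm ^+ 2)%:E)%E ->
  (\int[P]_t (w t ^+ 2)%:E = (k * sw ^+ 2)%:E)%E ->
  (\int[P]_t ((A * m t + B * w t) ^+ 2)%:E =
   (k * (A ^+ 2 * sm ^+ 2 + B ^+ 2 * sw ^+ 2))%:E)%E.
Proof.
move=> kE kE'.
rewrite (@source_symmetrization (fun z => (A * z.1 + B * z.2) ^+ 2)
  (fun z => A ^+ 2 * z.1 ^+ 2 + B ^+ 2 * z.2 ^+ 2)); last 3 first.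
- by measurability.
- by move=> z; rewrite sqr_ge0.
- by move=> a v /=; ring.
rewrite ge0_integralD_EFin; try by [measurability|move=> t; rewrite mulr_ge0// sqr_ge0].
rewrite !ge0_integralZ_EFin ?sqr_ge0//; try by [measurability|move=> t; rewrite sqr_ge0].
by rewrite kE kE' -!EFinM -EFinD; congr (_%:E); ring.
Qed.

(** The output is pure noise, and symmetrization turns the squared error into [m^2 + gd(w)^2]. *)
Lemma decoder_cost_uninformative_ge ge gd :
  {ae P, forall t, ge (m t) = 0} ->
  (\int[P]_t (m t ^+ 2)%:E <= decoder_cost m w ge gd)%E.
Proof.
move=> ge0; pose f (z : R * R) := (z.1 - gd z.2) ^+ 2.
have -> : (decoder_cost m w ge gd = \int[P]_t (f (m t, w t))%:E)%E.
  rewrite decoder_costE; apply: ge0_ae_eq_integral => //.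
  - by apply/measurable_EFinP; measurability.
  - by apply/measurable_EFinP; rewrite /f; measurability.
  - by move=> t _; rewrite lee_fin sqr_ge0.
  - by move=> t _; rewrite lee_fin sqr_ge0.
  - by apply: filterS ge0 => t ge0 _; rewrite ge0 add0r.
rewrite (@source_symmetrization f (fun z => z.1 ^+ 2 + gd z.2 ^+ 2)); last 3 first.
- by rewrite /f; measurability.
- by move=> z; rewrite sqr_ge0.
- by move=> a v; rewrite /f /=; ring.
apply: ge0_le_integral_EFin => /=.
- by measurability.
- by measurability.
- by move=> t; rewrite sqr_ge0.
- by move=> t; rewrite lerDl sqr_ge0.
Qed.

(* Weak linear signalling [a m] with the linear decoder that is optimal for it. *)
Lemma social_cost_lt_uninformative lambda ge gd : 0 <= lambda ->
  lambda < 2 * sm ^+ 2 / sw ^+ 2 -> {ae P, forall t, ge (m t) = 0} ->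
  (social_cost m w 0 lambda < total_cost m w 0 lambda ge gd)%E.
Proof.
move=> l0 lam ge0; have [k k0 [kE kE']] := second_moments sm0 sw0 gaussian.
have s20 : 0 < sm ^+ 2 by rewrite exprn_gt0.
have w20 : 0 < sw ^+ 2 by rewrite exprn_gt0.
rewrite ltr_pdivlMr// in lam.
(* [q] is the squared gain of the encoder. It is small enough that the strict bound on [lambda]
   survives replacing the noise variance by the output variance; the witness uses up at most half of
   the slack. *)
have [q q0 qlt] : exists2 q, 0 < q & lambda * (q * sm ^+ 2 + sw ^+ 2) < 2 * sm ^+ 2.
  exists ((2 * sm ^+ 2 - lambda * sw ^+ 2) / (2 * (lambda + 1) * sm ^+ 2)).
    by rewrite divr_gt0 ?subr_gt0// !mulr_gt0// ltr_wpDl.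
  have l1 : lambda + 1 != 0 by rewrite gt_eqF// ltr_wpDl.
  rewrite -subr_gt0 [ltRHS](_ : _ =
    (2 * sm ^+ 2 - lambda * sw ^+ 2) * ((lambda + 2) / (2 * (lambda + 1)))); last first.
    by field; rewrite l1 gt_eqF.
  by rewrite mulr_gt0 ?subr_gt0// divr_gt0 ?mulr_gt0// ltr_wpDl.
pose a := Num.sqrt q.
have a2 : a ^+ 2 = q by rewrite sqr_sqrtr// ltW.
(* Up to the common factor [k], [v] is the variance of the output; [c] is the regression coefficient
   of the source on it, with residual [sm^2 sw^2 / v]. *)
pose v := q * sm ^+ 2 + sw ^+ 2; pose c := a * sm ^+ 2 / v.
have v0 : 0 < v by rewrite addr_gt0// mulr_gt0.
have ma : measurable_fun [set: R] (fun x : R => a * x) by measurability.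
have mc : measurable_fun [set: R] (fun x : R => c * x) by measurability.
apply: (le_lt_trans (social_cost_le m w 0 lambda (policy_of ma) (policy_of mc))).
apply: (@lt_le_trans _ _ (2%:E * decoder_cost m w ge gd)%E); last first.
  rewrite total_cost_unbiasedE// leeDl// integral_EFin_ge0// => t.
  by rewrite mulr_ge0// sqr_ge0.
apply: (@lt_le_trans _ _ (2 * (k * sm ^+ 2))%:E); last first.
  by rewrite EFinM lee_pmul2l// -kE decoder_cost_uninformative_ge.
rewrite total_cost_unbiasedE// decoder_costE /=.
under eq_integral => t _.
  rewrite (_ : m t - _ = (1 - c * a) * m t + (- c) * w t); last by ring.
  over.
rewrite (second_moment_linear_combination _ _ kE kE').
under [X in (_ + X)%E]eq_integral => t _.
  rewrite exprMn a2 mulrA; over.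
rewrite ge0_integralZ_EFin ?mulr_ge0 ?(ltW q0)//;
  try by [measurability|move=> t; rewrite sqr_ge0].
rewrite kE -!EFinM -EFinD lte_fin.
rewrite (_ : (1 - c * a) ^+ 2 * sm ^+ 2 + (- c) ^+ 2 * sw ^+ 2 =
    sm ^+ 2 * sw ^+ 2 / v); last first.
  have -> : c * a = q * sm ^+ 2 / v by rewrite /c -a2; field; rewrite gt_eqF.
  have -> : (- c) ^+ 2 = q * sm ^+ 4 / v ^+ 2 by rewrite /c -a2; field; rewrite gt_eqF.
  by rewrite /v; field; rewrite -/v gt_eqF.
rewrite -subr_gt0 [ltRHS](_ : _ =
    k * sm ^+ 2 * q / v * (2 * sm ^+ 2 - lambda * v)); last first.
  by rewrite /v; field; rewrite -/v gt_eqF.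
by rewrite mulr_gt0 ?subr_gt0// divr_gt0// !mulr_gt0.
Qed.

End uninformative_equilibrium.

(** * Perturbation of an informative equilibrium *)

Section decoder_weights.
Context d (T : measurableType d) (R : realType) (P : probability T R).
Variables (m w : {RV P >-> R}) (ge gd : policy R).
Hypothesis nash_decoder : forall gd' : policy R,
  (decoder_cost m w ge gd <= decoder_cost m w ge gd')%E.
Hypothesis decoder_fin : (decoder_cost m w ge gd < +oo)%E.

Local Notation Y t := (ge (m t) + w t).

(* The decoder may shrink its action to [(1 - theta) gd]; the error is then a
   convex combination of the errors of [gd] and of the zero action. *)
Let decoder_weight1 (theta : R -> R) : measurable_fun [set: R] theta ->
  (forall y, 0 <= theta y <= 1) ->
  (\int[P]_t (theta (Y t) * (m t - gd (Y t)) ^+ 2)%:E <=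
   \int[P]_t (theta (Y t) * m t ^+ 2)%:E)%E.
Proof.
move=> mtheta theta01.
have mg' : measurable_fun [set: R] (fun y => (1 - theta y) * gd y) by measurability.
have mthetaY : measurable_fun [set: T] (fun t => theta (Y t)).
  by apply: measurableT_comp => //; measurability.
have th0 t : 0 <= theta (Y t) by have /andP[] := theta01 (Y t).
have th1 t : 0 <= 1 - theta (Y t) by rewrite subr_ge0; have /andP[] := theta01 (Y t).
pose a t := (1 - theta (Y t)) * (m t - gd (Y t)) ^+ 2.
have ma : measurable_fun [set: T] a by rewrite /a; measurability.
have a0 t : 0 <= a t by rewrite mulr_ge0 ?sqr_ge0.
have JE : (decoder_cost m w ge gd = \int[P]_t (a t)%:E +
    \int[P]_t (theta (Y t) * (m t - gd (Y t)) ^+ 2)%:E)%E.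
  rewrite decoder_costE -ge0_integralD_EFin//.
  - by apply: eq_integral => t _; rewrite /a; congr (_%:E); ring.
  - by measurability.
  - by move=> t; rewrite mulr_ge0 ?sqr_ge0.
(* The unshrunk part of the error is finite, so it may be cancelled from both sides. *)
have afin : (\int[P]_t (a t)%:E)%E \is a fin_num.
  rewrite ge0_fin_numE ?integral_EFin_ge0//; apply: le_lt_trans decoder_fin.
  by rewrite JE leeDl// integral_EFin_ge0// => t; rewrite mulr_ge0 ?sqr_ge0.
rewrite -(leeD2lE _ _ afin) -JE; apply: le_trans (nash_decoder (policy_of mg')) _.
rewrite decoder_costE -ge0_integralD_EFin//; last 2 first.
- by measurability.
- by move=> t; rewrite mulr_ge0 ?sqr_ge0.
apply: ge0_le_integral_EFin => /=.
- by measurability.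
- by measurability.
- by move=> t; rewrite sqr_ge0.
- move=> t; rewrite /a -subr_ge0 [leRHS](_ : _ =
    theta (Y t) * (1 - theta (Y t)) * gd (Y t) ^+ 2); last by ring.
  by rewrite mulr_ge0 ?sqr_ge0// mulr_ge0.
Qed.

(** Truncating [h] at a positive integer and dividing by that integer gives a weight in [0, 1];
    monotone convergence then removes the truncation. *)
Lemma decoder_weight (h : R -> R) : measurable_fun [set: R] h ->
  (forall y, 0 <= h y) ->
  (\int[P]_t (h (Y t) * (m t - gd (Y t)) ^+ 2)%:E <=
   \int[P]_t (h (Y t) * m t ^+ 2)%:E)%E.
Proof.
move=> mh h0.
pose hn n y := Num.min (h y) n%:R.
have hn0 n y : 0 <= hn n y by rewrite le_min h0 ler0n.
have hnh n y : hn n y <= h y by rewrite ge_min lexx.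
have mhn n : measurable_fun [set: R] (hn n) by exact: measurable_minr.
have mY : measurable_fun [set: T] (fun t => Y t) by measurability.
have mhY : measurable_fun [set: T] (fun t => h (Y t)).
  exact: (measurableT_comp mh).
have mhnY n : measurable_fun [set: T] (fun t => hn n (Y t)).
  exact: (measurableT_comp (mhn n)).
have bound n : (\int[P]_t (hn n (Y t) * (m t - gd (Y t)) ^+ 2)%:E <=
    \int[P]_t (h (Y t) * m t ^+ 2)%:E)%E.
  apply: (@le_trans _ _ (\int[P]_t (hn n (Y t) * m t ^+ 2)%:E)%E); last first.
    apply: ge0_le_integral_EFin; [by measurability|by measurability| |].
    - by move=> t; rewrite mulr_ge0 ?sqr_ge0.
    - by move=> t; rewrite ler_wpM2r ?sqr_ge0.
  case: n => [|n].
    have hn00 y : hn 0 y = 0 by apply/min_idPr; exact: h0.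
    under eq_integral do rewrite hn00 mul0r.
    rewrite integral0; apply: integral_EFin_ge0 => t.
    by rewrite mulr_ge0 ?sqr_ge0.
  have n0 : 0 < n.+1%:R :> R by rewrite ltr0n.
  have mth : measurable_fun [set: R] (fun y => n.+1%:R^-1 * hn n.+1 y) by measurability.
  have th01 y : 0 <= n.+1%:R^-1 * hn n.+1 y <= 1.
    rewrite mulr_ge0 ?invr_ge0 ?(ltW n0)//= mulrC ler_pdivrMr// mul1r.
    by rewrite ge_min lexx orbT.
  have := decoder_weight1 mth th01.
  under eq_integral do rewrite -mulrA.
  under [X in (_ <= X)%E -> _]eq_integral do rewrite -mulrA.
  rewrite !ge0_integralZ_EFin ?invr_ge0 ?(ltW n0)//;
    try by [measurability|move=> t; rewrite mulr_ge0 ?sqr_ge0].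
  by rewrite lee_pmul2l// lte_fin invr_gt0.
pose g n t := (hn n (Y t) * (m t - gd (Y t)) ^+ 2)%:E.
have limg t : limn (g ^~ t) = (h (Y t) * (m t - gd (Y t)) ^+ 2)%:E.
  apply/cvg_lim => //; apply: (@cvg_near_cst).
  near=> n; rewrite /g; congr (_ * _)%:E; apply/min_idPl.
  rewrite (le_trans (ltW (truncnS_gt _)))// ler_nat.
  by near: n; exact: nbhs_infty_ge.
under eq_integral => t _ do rewrite -limg.
have mg n : measurable_fun [set: T] (g n).
  by apply/measurable_EFinP; measurability.
have g0 n t : [set: T] t -> (0 <= g n t)%E.
  by move=> _; rewrite lee_fin mulr_ge0 ?sqr_ge0.
have ndg t : [set: T] t -> {homo g ^~ t : a b / (a <= b)%N >-> (a <= b)%E}.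
  move=> _ a b ab; rewrite lee_fin ler_wpM2r ?sqr_ge0//.
  by rewrite le_min !ge_min lexx/= ler_nat ab orbT.
rewrite (monotone_convergence P measurableT mg g0 ndg).
apply: lime_le.
  apply: ereal_nondecreasing_is_cvgn => a b ab; apply: ge0_le_integral => //.
  - by move=> t; exact: g0.
  - by move=> t _; exact: ndg.
by apply: nearW => n; exact: bound.
Unshelve. all: by end_near. Qed.

End decoder_weights.

(** * Density of the channel output *)

Section output_density.
Context {R : realType} (N : probability (measurableTypeR R) R).
Variables (ge : policy R) (s : R).
Hypothesis s0 : s != 0.
Local Notation mu := (@lebesgue_measure R).

Definition output_density (y : R) : R :=
  fine (\int[N]_a (normal_pdf (ge a) s y)%:E)%E.

Let kernel (z : R * R) := normal_pdf (ge z.1) s z.2.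

Let measurable_kernel : measurable_fun [set: R * R] kernel.
Proof. by rewrite /kernel; measurability. Qed.

Let kernel_ge0 z : 0 <= kernel z.
Proof. exact: normal_pdf_ge0. Qed.

(** The kernel is bounded by its peak, so the mixture is finite and [fine] loses nothing. *)
Lemma output_densityE y :
  ((output_density y)%:E = \int[N]_a (normal_pdf (ge a) s y)%:E)%E.
Proof.
rewrite fineK// ge0_fin_numE; last first.
  by apply: integral_EFin_ge0 => a; exact: normal_pdf_ge0.
apply: (@le_lt_trans _ _ (\int[N]_a (normal_peak s)%:E)%E).
  apply: ge0_le_integral_EFin => //.
  - exact: (measurable_section2 measurable_kernel).
  - by move=> a; exact: normal_pdf_ge0.
  - by move=> a; exact: normal_pdf_ub.
by rewrite integral_probability_cst ltry.
Qed.

Lemma output_density_gt0 y : 0 < output_density y.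
Proof.
rewrite -lte_fin output_densityE.
apply: (@ge0_integral_gt0 _ _ _ N _ [set: _]) => //.
- by apply/measurable_EFinP; exact: (measurable_section2 measurable_kernel).
- by move=> a; rewrite lee_fin normal_pdf_ge0.
- apply: (@lt_le_trans _ _ 1%E) => //; rewrite le_eqVlt; apply/orP; left.
  by apply/eqP; exact/esym/(@probability_setT _ _ _ N).
- by move=> a _; rewrite lte_fin normal_pdf_gt0.
Qed.

Lemma measurable_output_density : measurable_fun [set: R] output_density.
Proof.
apply: (measurableT_comp (@fine_measurable R setT measurableT)).
exact: (measurable_integral_section2 N measurable_kernel kernel_ge0).
Qed.

(** Integrating out the source first produces the output density, which cancels the division in the
    weight. *)
Lemma integral_output_density (F g : R -> R) :
  measurable_fun [set: R] F -> measurable_fun [set: R] g ->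
  (forall y, 0 <= F y) -> (forall y, 0 <= g y) ->
  (\int[(N \x mu)%E]_z
     (F z.2 * (g z.2 / output_density z.2) * normal_pdf (ge z.1) s z.2)%:E =
   \int[mu]_y (F y * g y)%:E)%E.
Proof.
move=> mF mg F0 g0; have p0 := output_density_gt0.
pose G y := F y * (g y / output_density y).
have mG : measurable_fun [set: R] G.
  apply: measurable_funM => //; apply: measurable_funM => //.
  rewrite (_ : (fun y => _) = (fun y => output_density y `^ (- 1))); last first.
    by apply/funext => y; rewrite powR_inv1// ltW.
  exact: (measurableT_comp (measurable_powR _) measurable_output_density).
have G0 y : 0 <= G y by rewrite mulr_ge0// divr_ge0// ltW.
have mk := measurable_kernel; have k0 := kernel_ge0.
rewrite (@tonelli2_EFin _ _ _ (fun z => G z.2 * kernel z)); last 2 first.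
- by apply: measurable_funM => //; apply: measurableT_comp.
- by move=> z; rewrite mulr_ge0.
apply: eq_integral => y _ /=; rewrite ge0_integralZ_EFin//; last first.
  exact: (measurable_section2 mk).
rewrite -output_densityE -EFinM /G; congr (_%:E).
by rewrite -!mulrA mulVf ?mulr1// gt_eqF.
Qed.

End output_density.

(** * Finite decoder cost under bounded deviations of the encoder *)

Section bounded_deviations.
Context d (T : measurableType d) (R : realType) (P : probability T R).
Variables (m w : {RV P >-> R}) (sm sw : R).
Hypotheses (sm0 : 0 < sm) (sw0 : 0 < sw).
Hypothesis gaussian : gaussian_source_and_noise m w sm sw.
Variables (ge gd : policy R).
Hypothesis nash_decoder : forall gd' : policy R,
  (decoder_cost m w ge gd <= decoder_cost m w ge gd')%E.
Hypothesis decoder_fin : (decoder_cost m w ge gd < +oo)%E.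
Variables (A : set R) (L : R).
Hypotheses (mA : measurable A) (A0 : (0 < normal_prob 0 sm A)%E).
Hypothesis geA : forall a, A a -> `|ge a| <= L.

Local Notation mu := (@lebesgue_measure R).
Local Notation N := (normal_prob 0 sm).
Local Notation phi c y := (normal_pdf c sw y).

Let swn0 : sw != 0. Proof. by rewrite gt_eqF. Qed.

(* Weighting the optimality of the decoder by [h = g / p] turns the law of the
   channel output, of density [p], into [g dy], which dominates the law of the
   output for every input bounded by [L]. *)
Let p := output_density N ge sw.
Let g y := phi L y + phi (- L) y.
Let h y := g y / p y.

Let p0 y : 0 < p y. Proof. exact: output_density_gt0. Qed.
Let g0 y : 0 <= g y. Proof. by rewrite addr_ge0 ?normal_pdf_ge0. Qed.
Let h0 y : 0 <= h y. Proof. by rewrite divr_ge0// ltW. Qed.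

Let mg : measurable_fun [set: R] g.
Proof. by rewrite /g; measurability. Qed.

Let mh : measurable_fun [set: R] h.
Proof.
apply: measurable_funM => //.
rewrite (_ : (fun y => _) = (fun y => p y `^ (- 1))); last first.
  by apply/funext => y; rewrite powR_inv1// ltW.
apply: (measurableT_comp (measurable_powR _)).
exact: (measurable_output_density _ _ swn0).
Qed.

Let mhY : measurable_fun [set: T] (fun t => h (ge (m t) + w t)).
Proof. by apply: (measurableT_comp mh); measurability. Qed.

(** The expectation equals the Lebesgue integral of [g^2 / p]. Since [p] is at least the
    contribution of [A], where the input is bounded by [L], this quotient is dominated by Gaussian
    densities. *)
Let hY_sqr_lty : (\int[P]_t (h (ge (m t) + w t) ^+ 2)%:E < +oo)%E.
Proof.
have [C C0 hC] := normal_pdf_envelope_sqr swn0 L.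
pose G y := phi (3 * L) y + phi (- (3 * L)) y.
have mG : measurable_fun [set: R] G by rewrite /G; measurability.
have G0 y : 0 <= G y by rewrite addr_ge0 ?normal_pdf_ge0.
have [n n0 nE] : exists2 n : R, 0 < n & N A = n%:E.
  have Nfin : (N A < +oo)%E.
    by apply: (@le_lt_trans _ _ 1%E); [exact: probability_le1|exact: ltry].
  have [n _ nE] := ge0_lty_EFin (ltW A0) Nfin.
  by exists n => //; rewrite -lte_fin -nE.
have mk : measurable_fun [set: R * R] (fun z => phi (ge z.1) z.2) by measurability.
(* The squared-envelope inequality is integrated over the source values in [A], of mass [n]. *)
have key y : n * g y ^+ 2 <= C * G y * p y.
  rewrite -lee_fin (EFinM (C * G y)) output_densityE//.
  rewrite -ge0_integralZ_EFin ?mulr_ge0//; last 2 first.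
  - exact: (measurable_section2 mk).
  - by move=> a; exact: normal_pdf_ge0.
  rewrite mulrC EFinM -nE.
  have -> : (N A = \int[N]_a (\1_A a : R)%:E)%E by rewrite integral_indic// setIT.
  have mI : measurable_fun [set: R] (\1_A : R -> R) by exact: measurable_indic.
  rewrite -ge0_integralZ_EFin ?sqr_ge0//.
  apply: ge0_le_integral_EFin.
  - by apply: measurable_funM => //; exact: measurable_cst.
  - by apply: measurable_funM => //; exact: (measurable_section2 mk).
  - by move=> a; rewrite mulr_ge0 ?sqr_ge0.
  - move=> a; rewrite indicE; case: (boolP (a \in A)) => aA; last first.
      by rewrite mulr0 mulr_ge0 ?mulr_ge0 ?normal_pdf_ge0.
    by rewrite mulr1 mulrAC; apply: hC; apply: geA; exact: set_mem.
have gp y : h y * g y <= C / n * G y.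
  rewrite /h mulrAC -expr2 ler_pdivrMr ?p0//.
  rewrite (_ : C / n * G y * p y = C * G y * p y / n); last by ring.
  by rewrite ler_pdivlMr// mulrC.
rewrite (source_output_integral sw0 gaussian (K := fun z => h z.2 ^+ 2) ge); last 2 first.
- by apply: measurable_funX; apply: measurableT_comp.
- by move=> z; rewrite sqr_ge0.
have -> : (\int[(N \x mu)%E]_z (h z.2 ^+ 2 * phi (ge z.1) z.2)%:E =
    \int[mu]_y (h y * g y)%:E)%E.
  rewrite -(integral_output_density N ge swn0 mh mg h0 g0).
  by apply: eq_integral => z _; rewrite expr2.
apply: (@le_lt_trans _ _ (\int[mu]_y (C / n * G y)%:E)%E).
  apply: ge0_le_integral_EFin => //.
  - by measurability.
  - by measurability.
  - by move=> y; rewrite mulr_ge0.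
rewrite ge0_integralZ_EFin ?divr_ge0 ?(ltW n0)//.
rewrite ge0_integralD_EFin; try by [measurability|move=> y; exact: normal_pdf_ge0].
by rewrite !integral_normal_pdf -EFinD -EFinM ltry.
Qed.

(** From [h m^2 <= h^2 + m^4] and the finite fourth moment of the source. *)
Let hY_source_lty : (\int[P]_t (h (ge (m t) + w t) * m t ^+ 2)%:E < +oo)%E.
Proof.
apply: (@le_lt_trans _ _ (\int[P]_t (h (ge (m t) + w t) ^+ 2 + m t ^+ 4)%:E)%E).
  apply: ge0_le_integral_EFin.
  - by measurability.
  - by measurability.
  - by move=> t; rewrite mulr_ge0 ?sqr_ge0.
  - move=> t; rewrite (exprM _ 2 2); move: (h _) (m t ^+ 2) => x y.
    by have := sqr_ge0 (x - y); have := sqr_ge0 (x + y); rewrite !expr2; nra.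
rewrite ge0_integralD_EFin; try by [measurability|move=> t; rewrite ?(exprM _ 2 2) sqr_ge0].
by rewrite lte_add_pinfty ?hY_sqr_lty ?(source_fourth_moment_lty sm0 gaussian).
Qed.

(** This is the growth bound on the decoder. The squared action is at most twice the squared error
    plus twice the squared source, and weighted optimality bounds the error term by the source
    term. *)
Let action_envelope_lty : (\int[mu]_y (gd y ^+ 2 * g y)%:E < +oo)%E.
Proof.
have m4 : (0 <= \int[P]_t (h (ge (m t) + w t) * m t ^+ 2)%:E)%E.
  by apply: integral_EFin_ge0 => t; rewrite mulr_ge0 ?sqr_ge0.
rewrite -(integral_output_density N ge swn0)//; last 2 first.
- by measurability.
- by move=> y; rewrite sqr_ge0.
rewrite -(source_output_integral sw0 gaussian
  (K := fun z => gd z.2 ^+ 2 * h z.2) ge); last 2 first.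
- apply: measurable_funM; first by measurability.
  exact: measurableT_comp.
- by move=> z; rewrite mulr_ge0 ?sqr_ge0.
apply: (@le_lt_trans _ _ (\int[P]_t
    (2 * (h (ge (m t) + w t) * (m t - gd (ge (m t) + w t)) ^+ 2) +
     2 * (h (ge (m t) + w t) * m t ^+ 2))%:E)%E).
  apply: ge0_le_integral_EFin => /=.
  - by measurability.
  - by measurability.
  - by move=> t; rewrite mulr_ge0 ?sqr_ge0.
  - move=> t; set H := h _; set x := gd _; rewrite -subr_ge0 [leRHS](_ : _ =
      H * (x - 2 * m t) ^+ 2); last by ring.
    by rewrite mulr_ge0 ?sqr_ge0 ?h0.
rewrite ge0_integralD_EFin; try by [measurability|nonnegativity].
rewrite !ge0_integralZ_EFin//; try by [measurability|move=> t; rewrite mulr_ge0 ?sqr_ge0 ?h0].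
have hm := decoder_weight nash_decoder decoder_fin mh h0.
apply: lte_add_pinfty; apply: lte_mul_pinfty; rewrite ?lee_fin//.
exact: le_lt_trans hm hY_source_lty.
Qed.

(** Here source and output are decoupled, so the error splits into the source's second moment and
    the weighted squared action. *)
Lemma envelope_error_lty :
  (\int[(N \x mu)%E]_z ((z.1 - gd z.2) ^+ 2 * g z.2)%:E < +oo)%E.
Proof.
have mgz : measurable_fun [set: R * R] (fun z => g z.2) by exact: measurableT_comp.
have sqg0 (x y : R) : 0 <= x ^+ 2 * g y by rewrite mulr_ge0 ?sqr_ge0.
apply: (@le_lt_trans _ _ (\int[(N \x mu)%E]_z
    (2 * (z.1 ^+ 2 * g z.2) + 2 * (gd z.2 ^+ 2 * g z.2))%:E)%E).
  apply: ge0_le_integral_EFin.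
  - by measurability.
  - by measurability.
  - by move=> z; exact: sqg0.
  - move=> z; rewrite -mulrDr -mulrDl mulrA ler_wpM2r//.
    move: z.1 (gd _) => x y.
    by have := sqr_ge0 (x + y); rewrite !expr2; nra.
rewrite ge0_integralD_EFin; try by [measurability|move=> z; rewrite mulr_ge0].
rewrite !ge0_integralZ_EFin//; try by [measurability|move=> z; exact: sqg0].
apply: lte_add_pinfty; apply: lte_mul_pinfty; rewrite ?lee_fin//.
- rewrite (@tonelli1_EFin _ _ _ (fun z => z.1 ^+ 2 * g z.2)); last 2 first.
  + by measurability.
  + by move=> z; exact: sqg0.
  have -> : (\int[N]_a \int[mu]_y (a ^+ 2 * g y)%:E = \int[N]_a (2 * a ^+ 2)%:E)%E.
    apply: eq_integral => a _; rewrite ge0_integralZ_EFin ?sqr_ge0//.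
    rewrite ge0_integralD_EFin; try by [measurability|move=> y; exact: normal_pdf_ge0].
    by rewrite !integral_normal_pdf -EFinD -EFinM mulrC.
  rewrite ge0_integralZ_EFin//; try by [measurability|move=> y; rewrite sqr_ge0].
  rewrite second_moment_normal_prob//.
  have [k k0 ->] := normal_prob01_second_moment R.
  by rewrite -!EFinM ltry.
- rewrite (@tonelli2_EFin _ _ _ (fun z => gd z.2 ^+ 2 * g z.2)); last 2 first.
  + by measurability.
  + by move=> z; exact: sqg0.
  have -> : (\int[mu]_y \int[N]_a (gd y ^+ 2 * g y)%:E =
      \int[mu]_y (gd y ^+ 2 * g y)%:E)%E.
    by apply: eq_integral => y _; exact: integral_probability_cst.
  exact: action_envelope_lty.
Qed.

(** At each source value the new kernel is either the old one or at most [C] times the envelope, so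
    the cost exceeds the old one by at most [C] times the envelope error. *)
Lemma decoder_cost_bounded_deviation (ge' : policy R) :
  (forall a, ge' a = ge a \/ `|ge' a| <= L) ->
  (decoder_cost m w ge' gd < +oo)%E.
Proof.
move=> ge'L; have [C C0 hC] := normal_pdf_le_envelope swn0 L.
pose K (z : R * R) := (z.1 - gd z.2) ^+ 2.
have mK : measurable_fun [set: R * R] K by rewrite /K; measurability.
have K0 z : 0 <= K z by rewrite sqr_ge0.
have mgz : measurable_fun [set: R * R] (fun z => g z.2) by exact: measurableT_comp.
have JE (f : policy R) : (decoder_cost m w f gd =
    \int[(N \x mu)%E]_z (K z * phi (f z.1) z.2)%:E)%E.
  by rewrite decoder_costE -(source_output_integral sw0 gaussian).
rewrite JE; apply: (@le_lt_trans _ _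
    (\int[(N \x mu)%E]_z (K z * phi (ge z.1) z.2 + C * (K z * g z.2))%:E)%E).
  apply: ge0_le_integral_EFin.
  - by measurability.
  - by measurability.
  - by move=> z; rewrite mulr_ge0 ?normal_pdf_ge0.
  - move=> z; rewrite mulrCA -mulrDr ler_wpM2l//.
    have [->|z1L] := ge'L z.1; first by rewrite lerDl mulr_ge0.
    by rewrite (le_trans (hC _ _ z1L))// lerDr normal_pdf_ge0.
rewrite ge0_integralD_EFin; try by [measurability|nonnegativity].
rewrite ge0_integralZ_EFin//; try by [measurability|move=> z; rewrite mulr_ge0].
rewrite -JE; apply: lte_add_pinfty => //.
by apply: lte_mul_pinfty; rewrite ?lee_fin ?envelope_error_lty.
Qed.

End bounded_deviations.

(** * Encoders shifted on a set of source values *)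

Section perturbed_encoder.
Context d (T : measurableType d) (R : realType) (P : probability T R).
Variables (m w : {RV P >-> R}) (sm sw : R).
Hypotheses (sm0 : 0 < sm) (sw0 : 0 < sw).
Hypothesis gaussian : gaussian_source_and_noise m w sm sw.
Variables (ge gd : policy R).

Lemma measurable_mfun_band (f : {mfun R >-> R}) (sg lo hi : R) :
  measurable [set x : R | lo <= sg * f x <= hi].
Proof.
rewrite (_ : mkset _ = (fun x => sg * f x) @^-1` `[lo, hi]%classic); last first.
  by apply/seteqP; split => x /=; rewrite in_itv.
rewrite -[X in measurable X]setTI.
have ms : measurable_fun [set: R] (fun x => sg * f x) by measurability.
by apply: ms => //; exact: measurable_itv.
Qed.

(** The bands exhaust the nonzero inputs, so if all were null the input would vanish almost
    surely. *)
Lemma informative_set : ~ {ae P, forall t, ge (m t) = 0} ->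
  exists (sg : R) (n : nat), (sg = 1 \/ sg = -1) /\
    (0 < P (m @^-1` [set x : R | (n.+1%:R^-1 <= sg * ge x <= n.+1%:R)%R]))%E.
Proof.
move=> notae; apply: contrapT => noset; apply: notae.
pose F (sg : R) (n : nat) := m @^-1` [set x : R | n.+1%:R^-1 <= sg * ge x <= n.+1%:R].
have mF sg n : measurable (F sg n).
  rewrite /F -[X in measurable X]setTI; apply: (measurable_funPT m) => //.
  exact: measurable_mfun_band.
have F0 sg n : sg = 1 \/ sg = -1 -> P.-negligible (F sg n).
  move=> sg1; apply/negligibleP; first exact: mF.
  apply/eqP; rewrite eq_le measure_ge0 andbT leNgt; apply/negP => Fpos.
  by apply: noset; exists sg, n.
apply: (@negligibleS _ _ _ _ (\bigcup_n F 1 n `|` \bigcup_n F (-1) n)); last first.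
  by apply: negligibleU; apply: negligible_bigcup => n; apply: F0; [left|right].
move=> t /=; rewrite /setC/= => /eqP x0.
have [n nx] : exists n, n.+1%:R^-1 <= `|ge (m t)| <= n.+1%:R.
  have a0 : 0 < `|ge (m t)| by rewrite normr_gt0.
  (* The integer part of the sum, plus one, exceeds both the absolute input and its inverse. *)
  exists (Num.truncn (`|ge (m t)| + `|ge (m t)|^-1)).
  have /ltW lt := truncnS_gt (`|ge (m t)| + `|ge (m t)|^-1).
  apply/andP; split.
    rewrite invf_ple ?posrE ?ltr0n// (le_trans _ lt)// lerDr.
    exact: ltW.
  by rewrite (le_trans _ lt)// lerDl invr_ge0 ltW.
have [ge0|lt0] := leP 0 (ge (m t)).
- by left; exists n => //; rewrite /F/= mul1r -[ge _]ger0_norm.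
- by right; exists n => //; rewrite /F/= mulN1r -[- ge _]ltr0_norm.
Qed.

Section fixed_set.
Variable A : set R.
Hypothesis mA : measurable A.

Let measurable_shift (s : R) :
  measurable_fun [set: R] (fun x => ge x + s * \1_A x).
Proof.
have mI : measurable_fun [set: R] (\1_A : R -> R) by exact: measurable_indic.
by measurability.
Qed.

Definition shift_encoder (s : R) : policy R := policy_of (measurable_shift s).

Lemma shift_encoderE s x : shift_encoder s x = ge x + s * \1_A x.
Proof. by []. Qed.

(** The decoder is kept, so the encoder enters only through the kernel, whose second difference is
    integrated against the fixed squared error. Outside the set nothing moves. *)
Lemma decoder_cost_second_difference : exists2 C, 0 <= C & forall (sg : R) n,
  sg = 1 \/ sg = -1 ->
  (decoder_cost m w (shift_encoder (sg * 2^-1 ^+ n)) gd +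
   decoder_cost m w (shift_encoder (- (sg * 2^-1 ^+ n))) gd <=
   2%:E * decoder_cost m w ge gd + (C * (2^-1 ^+ n) ^+ 2)%:E *
   (decoder_cost m w (shift_encoder sg) gd +
    decoder_cost m w (shift_encoder (- sg)) gd))%E.
Proof.
have swn0 : sw != 0 by rewrite gt_eqF.
have [C C0 hC] := normal_pdf_second_difference swn0; exists C => // sg n sg1.
pose K (z : R * R) := (z.1 - gd z.2) ^+ 2.
have mK : measurable_fun [set: R * R] K by rewrite /K; measurability.
have K0 z : 0 <= K z by rewrite sqr_ge0.
pose phi (f : policy R) (z : R * R) := normal_pdf (f z.1) sw z.2.
pose Kphi f z := K z * phi f z.
have mKphi f : measurable_fun [set: R * R] (Kphi f).
  by apply: measurable_funM => //; rewrite /phi; measurability.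
have Kphi0 f z : 0 <= Kphi f z by rewrite mulr_ge0// normal_pdf_ge0.
pose nu : {measure set (measurableTypeR R * measurableTypeR R) -> \bar R} :=
  (normal_prob 0 sm \x (@lebesgue_measure R))%E.
have JE (f : policy R) :
    (decoder_cost m w f gd = \int[nu]_z (Kphi f z)%:E)%E.
  by rewrite decoder_costE -(source_output_integral sw0 gaussian).
have Ce0 : 0 <= C * (2^-1 ^+ n) ^+ 2 by rewrite mulr_ge0 ?sqr_ge0.
have mKphi2 f f' : measurable_fun [set: R * R] (fun z => Kphi f z + Kphi f' z).
  exact: measurable_funD.
have Kphi20 f f' z : 0 <= Kphi f z + Kphi f' z by rewrite addr_ge0.
have two0 : 0 <= 2 :> R by [].
have sumE f f' : (decoder_cost m w f gd + decoder_cost m w f' gd =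
    \int[nu]_z (Kphi f z + Kphi f' z)%:E)%E.
  by rewrite !JE (ge0_integralD_EFin nu (mKphi f) (mKphi f')).
rewrite !sumE JE -(ge0_integralZ_EFin nu two0 (mKphi ge) (Kphi0 ge)).
rewrite -(ge0_integralZ_EFin nu Ce0 (mKphi2 _ _) (Kphi20 _ _)).
have m1 : measurable_fun [set: R * R] (fun z => 2 * Kphi ge z).
  by apply: measurable_funM => //; exact: measurable_cst.
have m2 f f' : measurable_fun [set: R * R]
    (fun z => C * (2^-1 ^+ n) ^+ 2 * (Kphi f z + Kphi f' z)).
  by apply: measurable_funM => //; exact: measurable_cst.
rewrite -(ge0_integralD_EFin nu m1 (m2 _ _)); last 2 first.
- by move=> z; rewrite mulr_ge0.
- by move=> z; rewrite mulr_ge0.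
apply: (ge0_le_integral_EFin nu (mKphi2 _ _) (measurable_funD m1 (m2 _ _))) => //.
move=> z /=; rewrite /Kphi -!mulrDr [2 * _]mulrCA [C * _ * _]mulrCA -mulrDr.
rewrite ler_wpM2l//.
rewrite /phi !shift_encoderE; have h := hC (ge z.1) z.2 n.
rewrite indicE; case: (_ \in _) => /=; last first.
  rewrite !mulr0 !addr0; rewrite (_ : forall x : R, x + x = 2 * x).
    by rewrite lerDl; nonnegativity.
  by move=> x; ring.
rewrite !mulr1; case: sg1 => ->; rewrite ?opprK ?mulN1r ?mul1r ?opprK//.
by rewrite addrC [in leRHS](addrC (normal_pdf (ge z.1 - 1) _ _)).
Qed.

End fixed_set.

End perturbed_encoder.

Section informative_equilibrium.
Context d (T : measurableType d) (R : realType) (P : probability T R).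
Variables (m w : {RV P >-> R}) (sm sw : R).
Hypotheses (sm0 : 0 < sm) (sw0 : 0 < sw).
Hypothesis gaussian : gaussian_source_and_noise m w sm sw.
Variables (ge gd : policy R) (A : set R) (mA : measurable A).

Local Notation shift s := (shift_encoder ge mA s).
Local Notation power lambda f := (\int[P]_t (lambda * f (m t) ^+ 2)%:E)%E.

(** Since 2 (x - sg e)^2 + (x + sg e)^2 = 3 x^2 - 2 e sg x + 3 e^2, the weights 2 and 1 leave a
    first-order gain of at least [2 * e * delta]. They are the weights with which the two optimality
    conditions are added later. *)
Lemma power_perturbation (lambda sg delta e : R) :
  0 <= lambda -> 0 <= delta -> 0 <= e -> sg ^+ 2 = 1 ->
  (forall x, A x -> delta <= sg * ge x) ->
  (2%:E * power lambda (shift (- (sg * e))) + power lambda (shift (sg * e)) +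
     (2 * lambda * e * delta)%:E * P (m @^-1` A) <=
   3%:E * power lambda ge + (3 * lambda * e ^+ 2)%:E * P (m @^-1` A))%E.
Proof.
move=> l0 d0 e0 sg1 geA.
have mmA : measurable (m @^-1` A).
  by rewrite -[X in measurable X]setTI; exact: (measurable_funPT m).
have mI : measurable_fun [set: T] (\1_(m @^-1` A) : T -> R).
  exact: measurable_indic.
have PE : P (m @^-1` A) = (\int[P]_t (\1_(m @^-1` A) t : R)%:E)%E.
  by rewrite integral_indic// setIT.
have mp (f : policy R) : measurable_fun [set: T] (fun t => lambda * f (m t) ^+ 2).
  by measurability.
have p0 (f : policy R) t : 0 <= lambda * f (m t) ^+ 2.
  by rewrite mulr_ge0 ?sqr_ge0.
have c10 : 0 <= 2 * lambda * e * delta by rewrite !mulr_ge0.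
have c20 : 0 <= 3 * lambda * e ^+ 2 by rewrite mulr_ge0 ?sqr_ge0// mulr_ge0.
have mk k (f : T -> R) : measurable_fun [set: T] f ->
    measurable_fun [set: T] (fun t => k * f t) by move=> mf; measurability.
have I0 t : 0 <= \1_(m @^-1` A) t :> R by [].
have k0 (k : R) (f : T -> R) : 0 <= k -> (forall t, 0 <= f t) ->
    forall t, 0 <= k * f t by move=> k0 f0 t; rewrite mulr_ge0.
have two0 : 0 <= 2 :> R by [].
have three0 : 0 <= 3 :> R by [].
rewrite PE -(ge0_integralZ_EFin P two0 (mp _) (p0 _)).
rewrite -(ge0_integralZ_EFin P three0 (mp _) (p0 _)).
rewrite -(ge0_integralZ_EFin P c10 mI I0) -(ge0_integralZ_EFin P c20 mI I0).
rewrite -(ge0_integralD_EFin P (mk _ _ (mp _)) (mp _) (k0 _ _ two0 (p0 _)) (p0 _)).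
have m1 := measurable_funD (mk 2 _ (mp (shift (- (sg * e))))) (mp (shift (sg * e))).
rewrite -(ge0_integralD_EFin P m1 (mk _ _ mI)); last 2 first.
- by move=> t /=; nonnegativity.
- exact: k0.
rewrite -(ge0_integralD_EFin P (mk _ _ (mp _)) (mk _ _ mI)); last 2 first.
- exact: k0.
- exact: k0.
apply: ge0_le_integral_EFin.
- exact: measurable_funD m1 (mk _ _ mI).
- exact: measurable_funD (mk _ _ (mp _)) (mk _ _ mI).
- by move=> t /=; nonnegativity.
move=> t /=.
rewrite (_ : \1_A (m t) = \1_(m @^-1` A) t); last by rewrite !indicE.
rewrite indicE; case: (boolP (t \in _)) => tA /=; last first.
  by rewrite !mulr0 !addr0 -subr_ge0 [leRHS](_ : _ = 0); [exact: lexx|ring].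
have {}tA := geA _ (set_mem tA).
rewrite !mulr1 -subr_ge0 [leRHS](_ : _ =
  2 * lambda * e * (sg * ge (m t) - delta) +
  3 * lambda * e ^+ 2 * (1 - sg ^+ 2)); last by ring.
by rewrite sg1 subrr mulr0 addr0 !mulr_ge0// subr_ge0.
Qed.

End informative_equilibrium.

(** For a positive [c], the bound n < 2^n makes 2^n exceed [B / c] at some [n]. *)
Lemma le0_dyadic (R : realType) (c B : R) :
  (forall n, c <= 2^-1 ^+ n * B) -> c <= 0.
Proof.
move=> cB; rewrite leNgt; apply/negP => c0.
pose n := (Num.truncn (B / c)).+1.
have Bn : B < n%:R * c by rewrite -ltr_pdivrMr// truncnS_gt.
have := cB n; rewrite exprVn mulrC ler_pdivlMr ?exprn_gt0// leNgt => /negP; apply.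
rewrite (lt_le_trans Bn)// mulrC ler_pM2l// -natrX ler_nat.
exact: ltnW (ltn_expl _ _).
Qed.

Section informative_game.
Context d (T : measurableType d) (R : realType) (P : probability T R).
Variables (m w : {RV P >-> R}) (sm sw : R).
Hypotheses (sm0 : 0 < sm) (sw0 : 0 < sw).
Hypothesis gaussian : gaussian_source_and_noise m w sm sw.

(* On a set where [ge] is bounded and bounded away from [0], move the channel
   input by [e] away from [0] (sum of the costs) and by [e] towards [0]
   (encoder cost). The second difference of the decoder cost is [O(e^2)],
   whereas the power term changes at first order with different weights. *)
Lemma social_cost_lt_informative (lambda : R) (ge gd : policy R) :
  0 < lambda -> nash_equilibrium m w 0 lambda ge gd ->
  (total_cost m w 0 lambda ge gd < +oo)%E ->
  ~ {ae P, forall t, ge (m t) = 0} ->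
  (social_cost m w 0 lambda < total_cost m w 0 lambda ge gd)%E.
Proof.
move=> l0 [nashe nashd] Tfin notae; have l0' := ltW l0.
have [sg [n [sg1 pos]]] := informative_set notae.
move: pos; set A : set R := (X in m @^-1` X) => pos.
have mA : measurable A by exact: measurable_mfun_band.
have sg_sqr : sg ^+ 2 = 1 by case: sg1 => ->; rewrite ?sqrrN expr1n.
have sg_norm : `|sg| = 1 by case: sg1 => ->; rewrite ?normrN normr1.
have geA x : A x -> n.+1%:R^-1 <= sg * ge x by case/andP.
have geA' x : A x -> `|ge x| <= n.+1%:R.
  move=> /andP[lo hi]; have <- : `|sg * ge x| = `|ge x| by rewrite normrM sg_norm mul1r.
  rewrite ger0_norm//.
  by apply: le_trans lo; rewrite invr_ge0.
have NA : (0 < normal_prob 0 sm A)%E by case: gaussian => mN _ _; rewrite -mN.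
have J0 f : (0 <= decoder_cost m w f gd)%E by exact: decoder_cost_ge0.
pose Q f := (\int[P]_t (lambda * f (m t) ^+ 2)%:E)%E.
have Q0 (f : policy R) : (0 <= Q f)%E.
  by apply: integral_EFin_ge0 => t; nonnegativity.
have encE f : encoder_cost m w 0 lambda f gd = (decoder_cost m w f gd + Q f)%E.
  rewrite encoder_costE// decoder_costE; congr (_ + _)%E.
  by apply: eq_integral => t _; rewrite subr0.
have totE f : total_cost m w 0 lambda f gd = (2%:E * decoder_cost m w f gd + Q f)%E.
  exact: total_cost_unbiasedE.
have Jfin : (decoder_cost m w ge gd < +oo)%E.
  apply: le_lt_trans Tfin; rewrite totE (@le_trans _ _ (2%:E * decoder_cost m w ge gd)%E)//.
    by rewrite lee_pemull// lee_fin ler1n.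
  by rewrite leeDl.
have Qfin : (Q ge < +oo)%E.
  by apply: le_lt_trans Tfin; rewrite totE leeDr// mule_ge0.
pose sh s := shift_encoder ge mA s.
(* On [A] the input is at most [n + 1] in absolute value and the shift at most 1, which gives the
   bound [L] used here. *)
have Jsh s : `|s| <= 1 -> (decoder_cost m w (sh s) gd < +oo)%E.
  move=> s1; apply: (decoder_cost_bounded_deviation sm0 sw0 gaussian nashd Jfin
    mA NA (L := n.+1%:R + 1)).
    by move=> a Aa; rewrite (le_trans (geA' _ Aa))// lerDl.
  move=> a; rewrite /sh shift_encoderE indicE.
  case: (boolP (a \in A)) => /= [/set_mem aA|_]; [right|left].
    by rewrite mulr1 (le_trans (ler_normD _ _))// lerD// geA'.
  by rewrite mulr0 addr0.
rewrite ltNge; apply/negP => TS.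
have [C C0 hC] := decoder_cost_second_difference sw0 gaussian ge gd mA.
have [j0 _ j0E] := ge0_lty_EFin (J0 ge) Jfin.
have [q0 _ q0E] := ge0_lty_EFin (Q0 ge) Qfin.
have sg_le : `|sg| <= 1 by rewrite sg_norm.
have sgN_le : `|- sg| <= 1 by rewrite normrN sg_norm.
have [u _ uE] := ge0_lty_EFin (J0 _) (Jsh _ sg_le).
have [v _ vE] := ge0_lty_EFin (J0 _) (Jsh _ sgN_le).
have [a a0 aE] : exists2 a : R, 0 < a & P (m @^-1` A) = a%:E.
  have Pfin : (P (m @^-1` A) < +oo)%E.
    apply: (@le_lt_trans _ _ 1%E); last exact: ltry.
    apply: probability_le1; rewrite -[X in measurable X]setTI.
    exact: (measurable_funPT m).
  have [a _ aE] := ge0_lty_EFin (ltW pos) Pfin.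
  by exists a => //; rewrite -lte_fin -aE.
(* Add twice the encoder's condition at [fm] to the supposed social optimality tested at [fp]. Both
   perturbed decoder costs then carry weight 2, their second difference applies, and the sum reads
   [e * c <= e^2 * B]. *)
pose c := 2 * lambda * n.+1%:R^-1 * a.
pose B := 2 * C * (u + v) + 3 * lambda * a.
suff : c <= 0 by rewrite leNgt !mulr_gt0// invr_gt0 ltr0n.
apply: (@le0_dyadic _ _ B) => k; set e := 2^-1 ^+ k.
have e0 : 0 < e by rewrite exprn_gt0.
have e1 : `|sg * e| <= 1.
  by rewrite normrM sg_norm mul1r gtr0_norm//; apply: exprn_ile1 => //; rewrite invf_le1// ler1n.
have eN1 : `|- (sg * e)| <= 1 by rewrite normrN.
have [jp _ jpE] := ge0_lty_EFin (J0 _) (Jsh _ e1).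
have [jm _ jmE] := ge0_lty_EFin (J0 _) (Jsh _ eN1).
pose fm := sh (- (sg * e)); pose fp := sh (sg * e).
have PW : (2%:E * Q fm + Q fp + (2 * lambda * e * n.+1%:R^-1)%:E * a%:E <=
    3%:E * q0%:E + (3 * lambda * e ^+ 2)%:E * a%:E)%E.
  rewrite -aE -q0E; by apply: power_perturbation => //; exact: ltW.
have Qle : (2%:E * Q fm + Q fp < +oo)%E.
  apply: (@le_lt_trans _ _ (3%:E * q0%:E + (3 * lambda * e ^+ 2)%:E * a%:E)%E); last first.
    by rewrite -!EFinM -EFinD ltry.
  by apply: le_trans PW; rewrite leeDl// -EFinM lee_fin !mulr_ge0 ?invr_ge0 ?(ltW e0) ?(ltW a0).
have [qm _ qmE] : exists2 q, 0 <= q & Q fm = q%:E.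
  apply: ge0_lty_EFin => //; apply: le_lt_trans Qle.
  rewrite (@le_trans _ _ (2%:E * Q fm)%E) ?leeDl//.
  by rewrite lee_pemull// lee_fin ler1n.
have [qp _ qpE] : exists2 q, 0 <= q & Q fp = q%:E.
  apply: ge0_lty_EFin => //; apply: le_lt_trans Qle.
  by rewrite leeDr// mule_ge0.
have := hC sg k sg1; rewrite -/e -/fp -/fm -/(sh sg) -/(sh (- sg)) j0E uE vE jpE jmE => SD.
have := nashe (fm); rewrite !encE -/(Q ge) -/(Q fm) j0E q0E jmE qmE => NE.
have := le_trans TS (social_cost_le m w 0 lambda (fp) gd).
rewrite !totE -/(Q ge) -/(Q fp) j0E q0E jpE qpE => TE.
move: PW SD NE TE; rewrite qmE qpE -!EFinM -!EFinD !lee_fin => PW SD NE TE.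
rewrite -(ler_pM2l e0) /c /B.
move: PW SD NE TE; clear; clearbody e; move: (n.+1%:R^-1) => dl PW SD NE TE; lra.
Qed.

End informative_game.

(** * From cost comparisons to ratios, and the final case analysis *)

Section ratio.
Context {R : realType}.
Implicit Types s c : \bar R.

Lemma le1_ratio s c : (0 <= s)%E -> (s < +oo)%E -> (0 < c)%E -> (s <= c)%E ->
  (1 <= c / s)%E.
Proof.
case: s => // r; rewrite lee_fin le_eqVlt => /predU1P[<- _ c0 _|r0 _ c0 rc].
  by rewrite inve0 gt0_muley// leey.
by rewrite inver gt_eqF// lee_pdivlMr// mul1e.
Qed.

Lemma lt1_ratio s c : (0 <= s)%E -> (s < +oo)%E -> (s < c)%E -> (1 < c / s)%E.
Proof.
case: s => // r; rewrite lee_fin le_eqVlt => /predU1P[<- _ c0|r0 _ rc].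
  by rewrite inve0 gt0_muley// ltry.
by rewrite inver gt_eqF// lte_pdivlMr// mul1e.
Qed.

End ratio.

(* For b = 0 and lambda >= 2 E[m^2] / E[w^2] the non-informative equilibrium
   x = u = 0 is socially optimal; strictness excludes only that equilibrium. *)
Theorem mainTheorem6 (d : measure_display) (T : measurableType d)
    (R : realType) (P : probability T R) (m w : {RV P >-> R})
    (sm sw b lambda : R) (ge gd : policy R) :
  0 < sm -> 0 < sw -> 0 <= lambda ->
  gaussian_source_and_noise m w sm sw ->
  nash_equilibrium m w b lambda ge gd ->
  ((social_cost m w b lambda <= total_cost m w b lambda ge gd)%E /\
   (1 <= price_of_anarchy m w b lambda ge gd)%E) /\
  ([\/ b != 0, lambda < 2 * sm ^+ 2 / sw ^+ 2
     | ~ {ae P, forall t, channel_input m ge t = 0}] ->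
   (social_cost m w b lambda < total_cost m w b lambda ge gd)%E /\
   (1 < price_of_anarchy m w b lambda ge gd)%E).
Proof.
move=> sm0 sw0 l0 gaussian nash.
have S0 := social_cost_ge0 m w b l0.
have Sfin := social_cost_lty sm0 sw0 gaussian b l0.
have ST := social_cost_le m w b lambda ge gd.
have T0 : (0 < total_cost m w b lambda ge gd)%E.
  rewrite (lt_le_trans (decoder_cost_gt0 sw0 gaussian ge gd))//.
  by rewrite leeDr// encoder_cost_ge0.
split; first by split => //; exact: le1_ratio.
move=> informative.
suff SltT : (social_cost m w b lambda < total_cost m w b lambda ge gd)%E.
  by split => //; exact: lt1_ratio.
(* An infinite equilibrium cost is strictly above the finite social cost. *)
have [Tfin|] := ltP (total_cost m w b lambda ge gd) +oo%E; last first.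
  by rewrite leye_eq => /eqP ->.
have [b0|b0] := eqVneq b 0; last exact: social_cost_lt_biased.
move: nash informative Tfin {S0 Sfin ST T0}; rewrite b0 => nash informative Tfin.
have [lam0|lam0] := eqVneq lambda 0.
  rewrite lam0 in Tfin *; exact: (social_cost_lt_unpowered sm0 sw0 gaussian).
have lgt0 : 0 < lambda by rewrite lt_def lam0.
(* With [b = 0] and a silent encoder, the only alternative left in the hypothesis is the upper bound
   on [lambda]. *)
have [silent|notsilent] := pselect {ae P, forall t, ge (m t) = 0}.
  case: informative => [|lam|//]; first by rewrite eqxx.
  exact: (social_cost_lt_uninformative sm0 sw0 gaussian).
exact: (social_cost_lt_informative sm0 sw0 gaussian).
Qed.
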